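(* Let $n\ge 1$ and let $u:\mathbb{C}^n\to\mathbb{R}$ be a smooth convex function satisfying, for all $x\in\mathbb{C}^n\cong\mathbb{R}^{2n}$, $$\ln\det\partial\bar\partial u(x)=\frac{1}{2}\,x\cdot Du(x)-u(x).$$ Assume $u$ is toric, i.e. $$u\left(z^1,\dots,z^n\right)=u\left(e^{\sqrt{-1}t^1}z^1,\dots,e^{\sqrt{-1}t^n}z^n\right)$$ for all $(z^1,\dots,z^n)\in\mathbb{C}^n$ and all $(t^1,\dots,t^n)\in\mathbb{R}^n$. Then $u$ is quadratic.
   Context: $\mathbb{C}^n$ is identified with $\mathbb{R}^{2n}$ by $z^i=x^i+\sqrt{-1}\,x^{n+i}$, $1\le i\le n$, with $x=(x^1,\dots,x^{2n})$. $Du$ is the real gradient of $u$ on $\mathbb{R}^{2n}$, and $x\cdot Du$ is the Euclidean inner product on $\mathbb{R}^{2n}$. $\partial\bar\partial u$ denotes the complex Hessian, i.e. the Hermitian $n\times n$ matrix $\left(\frac{\partial^2u}{\partial z^\alpha\partial\bar z^\beta}\right)$; being a solution of the equation includes that $\det\partial\bar\partial u>0$ everywhere, so that the logarithm is defined. Convexity is with respect to the real structure of $\mathbb{R}^{2n}$. ''Quadratic'' means that $u$ is a polynomial of degree at most $2$ in the real coordinates $x^1,\dots,x^{2n}$. *)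

(* Defs.v *)
From HB Require Import structures.
From mathcomp Require Import all_boot all_order all_algebra.
From mathcomp Require Import all_classical all_reals all_analysis.
From mathcomp Require Import complex.

Set Implicit Arguments.
Unset Strict Implicit.
Unset Printing Implicit Defensive.

Import Order.TTheory GRing.Theory Num.Theory.
Import numFieldNormedType.Exports.

Local Open Scope ring_scope.

Section RealCalculus.
Context {R : realType} {d : nat}.
Implicit Types (f : 'rV[R]_d -> R) (x : 'rV[R]_d).

Definition partial (i : 'I_d) f : 'rV[R]_d -> R :=
  fun x => 'D_(delta_mx 0 i) f x.

Definition iter_partial (s : seq 'I_d) f : 'rV[R]_d -> R := foldr partial f s.

(* The total operator 'D_v is only meaningful where the derivative exists,
   hence the derivability clause. *)
Definition smooth f : Prop :=
  forall s : seq 'I_d,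
    continuous (iter_partial s f) /\
    (forall i x, derivable (iter_partial s f) x (delta_mx 0 i)).

Definition gradient f x : 'rV[R]_d := \row_i partial i f x.

Definition dotprod (x y : 'rV[R]_d) : R := \sum_i x 0 i * y 0 i.

Definition quadratic f : Prop :=
  exists (a : 'M[R]_d) (b : 'rV[R]_d) (c : R), forall x,
    f x = \sum_i \sum_j a i j * x 0 i * x 0 j + \sum_i b 0 i * x 0 i + c.

End RealCalculus.

(* In 'rV[R]_(n + n), coordinate lshift n j is the real part of z^j, and
   coordinate rshift n j its imaginary part. *)
Section ComplexCalculus.
Context {R : realType} {n : nat}.
Implicit Types (f : 'rV[R]_(n + n) -> R[i]) (u : 'rV[R]_(n + n) -> R).

Definition realify (z : 'rV[R[i]]_n) : 'rV[R]_(n + n) :=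
  row_mx (map_mx (@complex.Re R) z) (map_mx (@complex.Im R) z).

Definition cpartial (k : 'I_(n + n)) f : 'rV[R]_(n + n) -> R[i] :=
  fun x => (partial k (fun y => complex.Re (f y)) x
            +i* partial k (fun y => complex.Im (f y)) x)%C.

Definition dz (a : 'I_n) f : 'rV[R]_(n + n) -> R[i] :=
  fun x => 2^-1 * (cpartial (lshift n a) f x - 'i%C * cpartial (rshift n a) f x).

Definition dzbar (b : 'I_n) f : 'rV[R]_(n + n) -> R[i] :=
  fun x => 2^-1 * (cpartial (lshift n b) f x + 'i%C * cpartial (rshift n b) f x).

Definition complex_hessian u (x : 'rV[R]_(n + n)) : 'M[R[i]]_n :=
  \matrix_(a, b) dz a (dzbar b (fun y => (u y)%:C%C)) x.

(* For complex numbers, 0 < w means that w is real and positive. *)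
Definition is_solution u : Prop :=
  forall x : 'rV[R]_(n + n),
    0 < \det (complex_hessian u x) /\
    ln (complex.Re (\det (complex_hessian u x))) =
      2^-1 * dotprod x (gradient u x) - u x.

Definition cis (t : R) : R[i] := (cos t +i* sin t)%C.

Definition toric u : Prop :=
  forall (z : 'rV[R[i]]_n) (t : 'rV[R]_n),
    u (realify z) = u (realify (\row_j (cis (t 0 j) * z 0 j))).

End ComplexCalculus.

(* Main.v *)
(** In the coordinates [s_i = ln |z_i|^2] a toric solution is a function [phi] on
    R^n with positive definite Hessian and
    [det D^2 phi = exp (sum_i s_i + psi - phi)], where [psi = sum_i d_i phi] is half
    of [x . Du].  Let [L F = tr ((D^2 phi)^-1 D^2 F) - sum_i d_i F].  Then
    [L phi = n - psi], and differentiating the equation along [(1, ..., 1)] gives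
    [L psi = n - psi], so that [L (psi - phi) = 0].  Moreover
    [<d phi, d psi> = psi] and [|d psi|^2 = S := sum_ij d_i d_j phi] for the metric
    [D^2 phi].  Normalize [phi] to vanish at the origin; convexity of [u] yields
    [0 <= phi <= 2 psi] and [S >= psi / 2].  With [m = 2 n + 1] and [A] large,
      [W = psi phi - A psi^-m + phi - sum_i s_i]
    satisfies [L W < 0] everywhere: the first term does the work at infinity, the
    second one near the origin, and the last one makes [W] infinite on the
    coordinate hyperplanes.  Since [|psi - phi| <= psi], the maximum principle
    applied to [+-(psi - phi) - eps W] on [psi >= a] gives [|psi - phi| <= a] as
    [eps] tends to 0, and then [psi = phi] as [a] tends to 0.  Hence [u - u 0] is
    homogeneous of degree 2, and a smooth function with this property is quadratic. *)
Require Import Defs.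
From HB Require Import structures.
From mathcomp Require Import all_boot all_order fingroup perm all_algebra.
From mathcomp Require Import all_classical all_reals all_analysis.
From mathcomp Require Import complex ring lra.

Set Implicit Arguments.
Unset Strict Implicit.
Unset Printing Implicit Defensive.

Import Order.TTheory GRing.Theory Num.Theory.
Import numFieldNormedType.Exports.

Local Open Scope ring_scope.

(** * Differentiability from continuous partial derivatives *)

Lemma continuous_sum (R : numFieldType) (T : topologicalType) (I : Type) (r : seq I)
    (F : I -> T -> R) :
  (forall i, continuous (F i)) -> continuous (fun x => \sum_(i <- r) F i x).
Proof.
move=> Fc; elim: r => [|i r IH] x.
  by under eq_fun do rewrite big_nil; exact: cvg_cst.
under eq_fun do rewrite big_cons.
by apply: continuousD; [exact: Fc|exact: IH].
Qed.

Section Calculus.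
Context {R : realType} {d : nat}.
Implicit Types (f : 'rV[R]_d -> R) (x v : 'rV[R]_d) (i : 'I_d).

Lemma is_derive_line f x v (t : R) l :
  is_derive (x + t *: v) v f l -> is_derive t 1 (fun s => f (x + s *: v)) l.
Proof.
move=> [fd <-].
have E : (fun h : R => h^-1 *: ((f \o shift (x + t *: v)) (h *: v) - f (x + t *: v)))
   = (fun h : R => h^-1 *: (((fun s => f (x + s *: v)) \o shift t) (h *: 1) - f (x + t *: v))).
  apply/funext => h; rewrite /shift /= [h *: 1]mulr1 scalerDl.
  by rewrite addrCA.
by split; rewrite /derivable /derive -E.
Qed.

Lemma ler_coord_norm x i : `|x 0 i| <= `|x|.
Proof.
rewrite [leRHS]/Num.Def.normr/= mx_normrE.
exact: (le_bigmax _ (fun j => `|x j.1 j.2|) (0, i)).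
Qed.

Lemma ler_norm_coord x (e : R) : 0 <= e -> (forall i, `|x 0 i| <= e) -> `|x| <= e.
Proof.
move=> e0 H; rewrite [leLHS]/Num.Def.normr/= mx_normrE bigmax_le//= => -[i j] _ /=.
by rewrite ord1.
Qed.

(** The increment is telescoped along the coordinate axes and the mean value theorem is applied to
    each piece; continuity of the partial derivatives at [x] makes the error [o(h)]. *)
Lemma differentiable_partial f :
  (forall i x, derivable f x (delta_mx 0 i)) ->
  (forall i, continuous (partial i f)) ->
  forall x, differentiable f x /\ forall v, 'D_v f x = \sum_i v 0 i * partial i f x.
Proof.
move=> fd fc x.
pose df v := \sum_i v 0 i * partial i f x.
have dfl : linear df.
  move=> a u v; rewrite /df scaler_sumr -big_split/=; apply: eq_bigr => i _.
  by rewrite !mxE mulrDl -mulrA.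
pose dfM := GRing.isLinear.Build _ _ _ _ _ dfl.
pose dfL : {linear 'rV[R]_d -> R} := HB.pack df dfM.
have dfc : continuous dfL.
  apply: continuous_sum => i y; apply: (@continuousM _ _ (fun v : 'rV[R]_d => v 0 i) (cst _)).
    exact: coord_continuous.
  exact: cst_continuous.
have step (h : 'rV[R]_d) (e : R) : 0 <= e ->
   (forall y, `|y| <= `|h| -> forall i, `|partial i f (x + y) - partial i f x| <= e) ->
   `|f (h + x) - f x - df h| <= e * d%:R * `|h|.
  move=> e0 H.
  (* [P k] moves [x] by the first [k] coordinates of [h] only, so consecutive points differ along
     one axis. *)
  pose P (k : nat) : 'rV[R]_d := x + \row_i (if (i < k)%N then h 0 i else 0).
  have P0 : P 0 = x.
    by rewrite /P -[RHS]addr0; congr (_ + _); apply/rowP => i; rewrite !mxE.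
  have Pd : P d = h + x.
    rewrite /P addrC; congr (_ + _); apply/rowP => i; rewrite !mxE.
    by rewrite ltn_ord.
  have PS (i : 'I_d) : P i.+1 = P i + h 0 i *: delta_mx 0 i.
    rewrite /P -addrA; congr (_ + _); apply/rowP => j; rewrite !mxE.
    rewrite ltnS eqxx/= -val_eqE/=; case: ltngtP => ji /=; rewrite ?mulr0 ?addr0//.
    by rewrite (val_inj ji) mulr1 add0r.
  have -> : f (h + x) - f x = \sum_(i < d) (f (P i.+1) - f (P i)).
    rewrite -(big_mkord xpredT (fun k => f (P k.+1) - f (P k))).
    by rewrite telescope_sumr// P0 Pd.
  rewrite /df -sumrB; apply: le_trans (ler_norm_sum _ _ _) _.
  have -> : e * d%:R * `|h| = \sum_(i < d) e * `|h|.
    by rewrite sumr_const card_ord -[RHS]mulr_natr mulrAC.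
  apply: ler_sum => i _.
  have MV (a b : R) : a <= b -> exists2 c, c \in `[a, b]%R &
     f (P i + b *: delta_mx 0 i) - f (P i + a *: delta_mx 0 i) =
       partial i f (P i + c *: delta_mx 0 i) * (b - a).
    move=> ab; apply: (@MVT_segment R (fun s => f (P i + s *: delta_mx 0 i))
       (fun s => partial i f (P i + s *: delta_mx 0 i)) a b ab).
      move=> s _; apply: is_derive_line; exact/derivableP/fd.
    apply: derivable_within_continuous => s _.
    by apply: ex_derive; apply: is_derive_line; exact/derivableP/fd.
  have [c cl cE] : exists2 c, `|c| <= `|h 0 i| &
     f (P i.+1) - f (P i) = h 0 i * partial i f (P i + c *: delta_mx 0 i).
    rewrite PS; have [h0|h0] := leP 0 (h 0 i).
      have [c cl] := MV _ _ h0; rewrite scale0r addr0 subr0 => ->.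
      exists c; last by rewrite mulrC.
      by move: cl; rewrite in_itv/= => /andP[c0 ch]; rewrite !ger0_norm.
    have [c cl] := MV _ _ (ltW h0); rewrite scale0r addr0 sub0r => E.
    exists c; last by rewrite -opprB E mulrN opprK mulrC.
    by move: cl; rewrite in_itv/= => /andP[c0 ch]; rewrite !ler0_norm ?lerN2// ltW.
  rewrite cE -mulrBr normrM mulrC ler_pM//; last exact: ler_coord_norm.
  rewrite /P -addrA; apply: H; apply: ler_norm_coord => // j.
  rewrite !mxE eqxx/=; case: ifP => ji.
    rewrite (_ : j == i = false) ?mulr0 ?addr0 ?ler_coord_norm//.
    by apply/eqP => E; move: ji; rewrite E ltnn.
  rewrite add0r; case: (j == i); rewrite ?mulr0 ?normr0// mulr1.
  exact: le_trans cl (ler_coord_norm _ _).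
have dfo : f \o shift x = cst (f x) + dfL +o_ (0 : 'rV[R]_d) id.
  apply/eqaddoP => e e0.
  (* Dividing by [d + 1] rather than [d] keeps the denominator positive when [d = 0]. *)
  have : \forall y \near (0 : 'rV[R]_d), forall i,
      `|partial i f (x + y) - partial i f x| <= e / (d%:R + 1).
    have := @filter_forall _ _
      (fun i y => `|partial i f (x + y) - partial i f x| <= e / (d%:R + 1))
      _ (nbhs_filter (0 : 'rV[R]_d)).
    apply => i.
    have := fc i x; move/cvgrPdist_le => /(_ (e / (d%:R + 1))).
    rewrite divr_gt0// ?ltr_wpDl// => /(_ isT).
    move=> /nbhs_normP[r /= r0 rP].
    apply/nbhs_ballP; exists r => //= y; rewrite -ball_normE/= sub0r normrN => yr.
    rewrite distrC; apply: rP => /=.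
    by rewrite /= opprD addNKr normrN.
  move=> /nbhs_ballP[r /= r0]; rewrite -ball_normE => rP.
  apply/nbhs_ballP; exists r => //= h; rewrite -ball_normE/= sub0r normrN => hr.
  have -> : (f \o shift x - (cst (f x) + dfL)) h = f (h + x) - f x - df h.
    by rewrite /= !fctE /= opprD addrA.
  apply: (le_trans (step h (e / (d%:R + 1)) _ _)).
  - by rewrite divr_ge0 ?addr_ge0// ltW.
  - by move=> y yh i; apply: rP; rewrite /= sub0r normrN (le_lt_trans yh).
  - rewrite ler_wpM2r// -mulrA ler_piMr ?(ltW e0)//.
    by rewrite ler_pdivrMl ?ltr_wpDl// mulr1 lerDl.
have dE := diff_unique dfc dfo.
have fdiff : differentiable f x.
  by apply/diff_locallyP; rewrite dE.
by split => // v; rewrite deriveE// dE.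
Qed.
End Calculus.

(** * Smooth functions: closure properties, symmetry of second derivatives, chain rule *)

Section Smooth.
Context {R : realType} {d : nat}.
Implicit Types (f g : 'rV[R]_d -> R) (x v : 'rV[R]_d) (i : 'I_d).

Lemma smooth_continuous f : smooth f -> continuous f.
Proof. by move=> /(_ [::]) []. Qed.

Lemma smooth_derivable f i x : smooth f -> derivable f x (delta_mx 0 i).
Proof. by move=> /(_ [::]) [_]; exact. Qed.

Lemma smooth_partial f i : smooth f -> smooth (partial i f).
Proof.
by move=> fs s; have := fs (rcons s i); rewrite /iter_partial foldr_rcons.
Qed.

Lemma smooth_differential f x : smooth f ->
  differentiable f x /\ forall v, 'D_v f x = \sum_i v 0 i * partial i f x.
Proof.
move=> fs; apply: differentiable_partial => [i y|i]; first exact: smooth_derivable.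
exact/smooth_continuous/smooth_partial.
Qed.

Lemma smooth_is_derive f x v : smooth f -> is_derive x v f (\sum_i v 0 i * partial i f x).
Proof.
move=> fs; have [fd <-] := smooth_differential x fs.
exact/derivableP/diff_derivable.
Qed.

(** Coinduction principle: iterated partial derivatives never leave the class [P], so smoothness is
    proved by exhibiting an invariant class. *)
Lemma smooth_coind (P : ('rV[R]_d -> R) -> Prop) :
  (forall f, P f -> [/\ continuous f, forall i x, derivable f x (delta_mx 0 i) &
     forall i, P (partial i f)]) ->
  forall f, P f -> smooth f.
Proof.
move=> HP f Pf s.
suff /HP[? ? _] : P (iter_partial s f) by split.
by elim: s => [//|i s /HP[_ _ HP']]; exact: HP'.
Qed.

(* The closure of the smooth functions under these operations is
   stable under partial derivatives, hence consists of smooth functions. *)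
Inductive smooth_closure : ('rV[R]_d -> R) -> Prop :=
| closure_smooth f : smooth f -> smooth_closure f
| closure_add f g : smooth_closure f -> smooth_closure g -> smooth_closure (f \+ g)
| closure_scale c f : smooth_closure f -> smooth_closure (fun x => c * f x)
| closure_coord i f : smooth_closure f -> smooth_closure (fun x => x 0 i * f x).

Lemma is_derive_coord i j x :
  is_derive x (delta_mx 0 j) (fun y : 'rV[R]_d => y 0 i) (i == j)%:R.
Proof.
split; first exact/diff_derivable/differentiable_coord.
have E : 'D_(delta_mx 0 j) (id : 'rV[R]_d -> 'rV[R]_d) x = delta_mx 0 j := derive_id _ _.
move/matrixP/(_ 0 i): E; rewrite derive_mx; last exact: derivable_id.
by rewrite !mxE eqxx.
Qed.

Lemma smooth_closureP f : smooth_closure f -> smooth f.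
Proof.
apply: smooth_coind => {}f; elim=> {f}
  [f fs|f g fc [f1 f2 f3] gc [g1 g2 g3]|c f fc [f1 f2 f3]|k f fc [f1 f2 f3]].
- split; [exact: smooth_continuous|by move=> *; exact: smooth_derivable|].
  by move=> i; apply/closure_smooth/smooth_partial.
- split=> [x|i x|i]; first exact: continuousD (f1 x) (g1 x).
    exact: derivableD.
  rewrite (_ : partial i _ = partial i f \+ partial i g); first exact: closure_add.
  by apply/funext => x; rewrite /partial/= deriveD.
- have fd i x : is_derive x (delta_mx 0 i) (fun x => c * f x) (c * partial i f x).
    by apply: is_deriveZ; exact: derivableP.
  split=> [x|i x|i]; first by apply: continuousM; [exact: cst_continuous|exact: f1].
    by have [] := fd i x.
  rewrite (_ : partial i _ = fun x => c * partial i f x); first exact: closure_scale.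
  by apply/funext => x; rewrite /partial/=; have [] := fd i x.
- have fd i x : is_derive x (delta_mx 0 i) (fun x => x 0 k * f x)
      (x 0 k * partial i f x + (k == i)%:R * f x).
    have := @is_deriveM _ _ _ _ x _ _ _ (is_derive_coord k i x) (derivableP (f2 i x)).
    by rewrite /GRing.scale/= [f x * _]mulrC.
  split=> [x|i x|i].
  + by apply: continuousM; [exact: coord_continuous|exact: f1].
  + by have [] := fd i x.
  + rewrite (_ : partial i _ = (fun x => x 0 k * partial i f x) \+ (fun x => (k == i)%:R * f x)).
      by apply: closure_add; [exact: closure_coord|exact: closure_scale].
    by apply/funext => x; rewrite /partial/=; have [] := fd i x.
Qed.

(** Schwarz's theorem. The second difference of [f] over a square of side [h] is [h^2] times either
    mixed derivative, each taken at some point near [x]; continuity then lets both points tend to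
    [x]. *)
Lemma partialC f i j : smooth f -> partial i (partial j f) = partial j (partial i f).
Proof.
move=> fs; apply/funext => x.
have mean (g dg : R -> R) (h : R) : (forall s : R, is_derive s 1 g (dg s)) -> 0 < h ->
    exists2 c, `|c| <= h & g h - g 0 = h * dg c.
  move=> gd h0.
  have [|c ch] := @MVT_segment R g dg 0 h (ltW h0) (fun s _ => gd s).
    by apply: derivable_within_continuous => s _; apply: ex_derive; exact: gd.
  rewrite subr0 mulrC => E; exists c => //.
  by move: ch; rewrite in_itv/= => /andP[c0 ch]; rewrite ger0_norm.
have line (g : 'rV[R]_d -> R) k y (s : R) : smooth g ->
    is_derive s 1 (fun s => g (y + s *: delta_mx 0 k)) (partial k g (y + s *: delta_mx 0 k)).
  by move=> gs; apply/is_derive_line/derivableP/smooth_derivable.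
have square k l (h : R) : 0 < h -> exists2 y, `|y| <= h + h &
    f (x + h *: delta_mx 0 k + h *: delta_mx 0 l) - f (x + h *: delta_mx 0 l)
    - (f (x + h *: delta_mx 0 k) - f x) = h * (h * partial l (partial k f) (x + y)).
  move=> h0.
  have [c ch E] := mean (fun s => f (x + h *: delta_mx 0 l + s *: delta_mx 0 k)
      - f (x + s *: delta_mx 0 k)) _ h (fun s => is_deriveB (line _ k _ s fs) (line _ k _ s fs)) h0.
  have [e eh E'] := mean _ _ h (fun s => line _ l (x + c *: delta_mx 0 k) s
    (smooth_partial k fs)) h0.
  exists (c *: delta_mx 0 k + e *: delta_mx 0 l).
    rewrite (le_trans (ler_normD _ _))// !normrZ; apply: lerD.
    - rewrite -[leRHS]mulr1 ler_pM//; apply: ler_norm_coord => // m.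
      by rewrite mxE eqxx/=; case: (_ == _); rewrite ?normr1 ?normr0.
    - rewrite -[leRHS]mulr1 ler_pM//; apply: ler_norm_coord => // m.
      by rewrite mxE eqxx/=; case: (_ == _); rewrite ?normr1 ?normr0.
  move: E' E; rewrite addrA scale0r addr0 => <-; rewrite !scale0r !addr0.
  by rewrite ![x + h *: delta_mx 0 l + _ *: delta_mx 0 k]addrAC => <-; ring.
apply/eqP; rewrite -subr_eq0 -normr_le0; apply/ler_addgt0Pr => /= e e0; rewrite add0r.
have near_e k l : exists2 r : R, 0 < r & forall y, `|y| < r ->
    `|partial k (partial l f) x - partial k (partial l f) (x + y)| <= e / 2.
  have := smooth_continuous (smooth_partial k (smooth_partial l fs)).
  move/(_ x)/cvgrPdist_le => /(_ (e / 2)); rewrite divr_gt0// => /(_ isT).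
  move=> /nbhs_ballP[r /= r0 rP]; exists r => // y yr; apply: rP.
  by rewrite -ball_normE/= opprD addNKr normrN.
have [r r0 rP] := near_e i j; have [q q0 qP] := near_e j i.
(* The intermediate points lie within [h + h] of [x], which must stay below both radii. *)
pose h := Num.min r q / 4.
have h0 : 0 < h by rewrite divr_gt0// lt_min r0 q0.
have hh : h + h < Num.min r q by rewrite /h; have := h0; rewrite /h; lra.
have [y yh yE] := square j i h h0; have [z zh zE] := square i j h h0.
have yz : partial i (partial j f) (x + y) = partial j (partial i f) (x + z).
  have hn := lt0r_neq0 h0; apply/(mulfI hn)/(mulfI hn).
  apply: etrans (esym yE) _; apply: etrans zE.
  rewrite [x + h *: delta_mx 0 j + _]addrAC; ring.
move: hh; rewrite lt_min => /andP[hr hq].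
have := rP y (le_lt_trans yh hr); have := qP z (le_lt_trans zh hq); rewrite yz.
move: (partial i (partial j f) x) (partial j (partial i f) x) (partial j (partial i f) _).
move=> a b c; rewrite !ler_norml => /andP[H1 H2] /andP[H3 H4].
clear -H1 H2 H3 H4; lra.
Qed.

Lemma smooth_comp_derive f (c : R -> 'rV[R]_d) (t : R) (dc : 'rV[R]_d) : smooth f ->
  (forall i, is_derive t 1 (fun s => c s 0 i) (dc 0 i)) ->
  is_derive t 1 (fun s => f (c s)) (\sum_i dc 0 i * partial i f (c t)).
Proof.
move=> fs cd.
have cdt : derivable c t 1.
  by apply/derivable_mxP => i j; rewrite ord1; case: (cd j).
have cdiff : differentiable c t by apply/derivable1_diffP.
have [fd <-] := smooth_differential (c t) fs.
have dcE : 'D_1 c t = dc.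
  rewrite derive_mx//; apply/rowP => j; rewrite !mxE.
  by have [_ <-] := cd j.
split; first by apply/derivable1_diffP; exact: differentiable_comp.
rewrite deriveE; last exact: differentiable_comp.
by rewrite (diff_comp cdiff fd)/= -(deriveE _ cdiff) dcE (deriveE _ fd).
Qed.
End Smooth.

(** * Second-order jets of functions of one real variable *)

Section Jet2.
Context {R : realType}.

(** Value, first and second derivative at 0. The function is differentiable on the whole line, its
    derivative only at 0; this is what the second derivative test requires. *)
Definition jet2 (g : R -> R) (g0 g1 g2 : R) : Prop :=
  g 0 = g0 /\ exists2 dg : R -> R, forall t : R, is_derive t 1 g (dg t) &
    dg 0 = g1 /\ is_derive (0 : R) 1 dg g2.

Lemma jet2_eq g g0 g1 g2 h0 h1 h2 : jet2 g g0 g1 g2 ->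
  g0 = h0 -> g1 = h1 -> g2 = h2 -> jet2 g h0 h1 h2.
Proof. by move=> H <- <- <-. Qed.

Lemma jet2_cst c : jet2 (cst c) c 0 0.
Proof.
split => //; exists (cst 0) => [t|]; first exact: is_derive_cst.
by split=> //; exact: is_derive_cst.
Qed.

Lemma jet2_affine a b : jet2 (fun t => a + t * b) a b 0.
Proof.
split; first by rewrite mul0r addr0.
exists (cst b) => [t|]; last by split=> //; exact: is_derive_cst.
by apply: is_derive_eq; rewrite /GRing.scale/=; ring.
Qed.

Lemma jet2D g h g0 g1 g2 h0 h1 h2 : jet2 g g0 g1 g2 -> jet2 h h0 h1 h2 ->
  jet2 (fun t => g t + h t) (g0 + h0) (g1 + h1) (g2 + h2).
Proof.
move=> [<- [dg gd [<- dgd]]] [<- [dh hd [<- dhd]]]; split => //.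
by exists (fun t => dg t + dh t) => [t|]; [exact: is_deriveD|split=> //; exact: is_deriveD].
Qed.

Lemma jet2Z c g g0 g1 g2 : jet2 g g0 g1 g2 ->
  jet2 (fun t => c * g t) (c * g0) (c * g1) (c * g2).
Proof.
move=> [<- [dg gd [<- dgd]]]; split => //.
by exists (fun t => c * dg t) => [t|]; [exact: is_deriveZ|split=> //; exact: is_deriveZ].
Qed.

Lemma jet2M g h g0 g1 g2 h0 h1 h2 : jet2 g g0 g1 g2 -> jet2 h h0 h1 h2 ->
  jet2 (fun t => g t * h t) (g0 * h0) (g0 * h1 + h0 * g1) (g0 * h2 + h0 * g2 + 2 * g1 * h1).
Proof.
move=> [<- [dg gd [<- dgd]]] [<- [dh hd [<- dhd]]]; split => //.
exists (fun t => g t * dh t + h t * dg t) => [t|]; first exact: is_deriveM.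
split=> //; apply: is_derive_eq.
rewrite /GRing.scale/=; ring.
Qed.

Lemma jet2_comp (F dF : R -> R) (ddF : R) (g : R -> R) (g0 g1 g2 : R) :
  (forall t, is_derive (g t) 1 F (dF (g t))) -> is_derive g0 1 dF ddF ->
  jet2 g g0 g1 g2 ->
  jet2 (F \o g) (F g0) (dF g0 * g1) (ddF * g1 ^+ 2 + dF g0 * g2).
Proof.
move=> Fd dFd [E [dg gd [<- dgd]]]; subst g0; split => //.
have comp (G : R -> R) a t : is_derive (g t) 1 G a -> is_derive t 1 (G \o g) (a * dg t).
  by move=> Gd; exact: is_derive1_comp.
exists (fun t => dF (g t) * dg t) => [t|]; first exact: comp.
split=> //; have := comp _ _ 0 dFd => H; apply: is_derive_eq.
rewrite /GRing.scale/=; ring.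
Qed.

Lemma jet2_expN m (g : R -> R) (g0 g1 g2 : R) : (forall t, 0 < g t) -> jet2 g g0 g1 g2 ->
  jet2 (fun t => g t ^- m) (g0 ^- m) (- (m%:R * g0 ^- m.+1 * g1))
    (m%:R * m.+1%:R * g0 ^- m.+2 * g1 ^+ 2 - m%:R * g0 ^- m.+1 * g2).
Proof.
move=> gp gj.
have Fd k (t : R) : 0 < t -> is_derive t 1 (fun x => x ^- k) (- (k%:R * t ^- k.+1)).
  move=> t0; have tk : t ^+ k != 0 by rewrite expf_neq0// gt_eqF.
  have [Xd XE] : is_derive t 1 (fun x : R => x ^+ k) (k%:R * t ^+ k.-1).
    by split; [exact: exprn_derivable|rewrite exp_derive /GRing.scale/= mulr1].
  split; first exact: derivableV.
  rewrite deriveV// XE.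
  rewrite /GRing.scale/=; case: k tk {Xd XE} => [|k] tk; first by rewrite mulr0n !mul0r mulr0 oppr0.
  have tk' : t ^+ k != 0 by rewrite expf_neq0// gt_eqF.
  by rewrite /= !exprS; field; rewrite tk' gt_eqF.
have g00 : 0 < g0 by case: gj => <- _.
have := @jet2_comp (fun x => x ^- m) (fun x => - (m%:R * x ^- m.+1))
  (m%:R * m.+1%:R * g0 ^- m.+2) g g0 g1 g2 (fun t => Fd m _ (gp t)) _ gj.
have H : is_derive g0 1 (fun x => - (m%:R * x ^- m.+1)) (m%:R * m.+1%:R * g0 ^- m.+2).
  have ? := Fd m.+1 g0 g00; apply: is_derive_eq.
  by rewrite /GRing.scale/= mulrN opprK mulrA.
by move/(_ H)/jet2_eq; apply => //; rewrite mulNr.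
Qed.

(** If [g2] were positive, [dg] would be positive just to the right of 0, and by the mean value
    theorem [g] would exceed [g 0] there. *)
Lemma jet2_max g g0 g1 g2 : jet2 g g0 g1 g2 ->
  (\forall t \near (0 : R), g t <= g 0) -> g1 = 0 /\ g2 <= 0.
Proof.
move=> [_ [dg gd [<- dgd]]] /nbhs_ballP[r /= r0 rP].
have {}rP t : `|t| < r -> g t <= g 0.
  by move=> tr; apply: rP; rewrite /ball/= sub0r normrN.
have gder t : derivable g t 1 by case: (gd t).
have dg0 : dg 0 = 0.
  have [_ <-] := gd 0.
  apply: (@derive_val _ _ _ _ _ _ _ (@derive1_at_max R g (- r) r 0 _ _ _ _)) => //.
  - by rewrite (@le_trans _ _ 0) ?oppr_le0// ltW.
  - by rewrite in_itv/= oppr_lt0 r0.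
  - by move=> t; rewrite in_itv/= => tr; apply: rP; rewrite ltr_norml.
split=> //; rewrite leNgt; apply/negP => g20.
have : \forall h \near dnbhs (0 : R), 0 < h^-1 *: (dg (h *: 1 + 0) - dg 0).
  have [dgdt E] := dgd; have : 0 < 'D_1 dg 0 by rewrite E.
  by move=> H; apply: (cvgr_gt _ dgdt).
rewrite dg0 => /nbhs_ballP[q /= q0 qP].
pose s := Num.min r q / 2.
have s0 : 0 < s by rewrite divr_gt0// lt_min r0.
have sm : s < Num.min r q by have := s0; rewrite /s; lra.
move: sm; rewrite lt_min => /andP[sr sq].
have [c] := @MVT R g dg 0 s s0 (fun t _ => gd t) (derivable_within_continuous
   (fun t _ => gder t)).
rewrite in_itv/= subr0 => /andP[c0 cs] E.
have := rP s; rewrite gtr0_norm// => /(_ sr); rewrite -subr_le0 E.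
apply/negP; rewrite -ltNge mulr_gt0//.
have := qP c; rewrite /ball/= sub0r normrN gtr0_norm// => /(_ (lt_trans cs sq)).
by rewrite gt_eqF// => /(_ isT); rewrite addr0 subr0 [c *: 1]mulr1 pmulr_rgt0// invr_gt0.
Qed.

End Jet2.

(** * The numerical inequality behind the barrier *)

Section Barrier.
Context {R : realType}.

(** The constant [A] of the header. Its first factor makes [A p^-(2 n + 2)] at least the second
    factor for [p < n + 4], and the second factor exceeds the remaining positive terms in that
    range. *)
Definition barrier_const (n : nat) : R :=
  (n%:R + 4) ^+ (2 * n).+2 * ((3 * n%:R + 1) * (n%:R + 4) + 2 * n%:R + 1).

Lemma barrier_const_gt0 n : 0 < barrier_const n.
Proof.
rewrite /barrier_const; have := ler0n R n; move: n%:R => N N0.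
rewrite mulr_gt0//; first by rewrite exprn_gt0// ltr_wpDl.
nra.
Qed.

(* This is [L W < 0] for the function [W] of the header, with [p], [g], [s] standing for
   the values of [psi], [phi], [S]. *)
Lemma barrier_neg n (p g s : R) : 0 < p -> 0 <= g -> g <= 2 * p -> p / 2 <= s ->
  (n%:R - p) * (p + g) + p + 2 * n%:R
   + barrier_const n * ((2 * n).+1%:R * p ^- (2 * n).+2 * (n%:R - p)
     - (2 * n).+1%:R * (2 * n).+2%:R * p ^- (2 * n).+3 * s) < 0.
Proof.
move=> p0 g0 gp ps.
have q0 : 0 < p ^- (2 * n).+2 by rewrite invr_gt0 exprn_gt0.
set q := p ^- (2 * n).+2 in q0 *.
have pq : p ^- (2 * n).+3 = q / p by rewrite /q [p ^+ (2 * n).+3]exprS invfM mulrC.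
have mE : (2 * n).+1%:R = 2 * n%:R + 1 :> R by rewrite -addn1 natrD natrM.
have mE' : (2 * n).+2%:R = 2 * (n%:R + 1) :> R by rewrite -addn1 natrD mE; ring.
rewrite pq mE mE'.
have Aq : p < n%:R + 4 ->
    (3 * n%:R + 1) * (n%:R + 4) + 2 * n%:R + 1 <= barrier_const n * q.
  move=> pN; rewrite /barrier_const mulrAC -[leLHS]mul1r ler_pM2r; last first.
    by have := ler0n R n; move: n%:R => N N0; nra.
  rewrite /q ler_pdivlMr ?exprn_gt0// mul1r.
  have N4 : 0 <= n%:R + 4 :> R by rewrite addr_ge0.
  by rewrite ler_pXn2r ?nnegrE ?(ltW p0) ?(ltW pN).
have A0 := barrier_const_gt0 n; have N0 := ler0n R n.
move: (barrier_const n) n%:R A0 N0 Aq => A N A0 N0 Aq {mE mE' pq}.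
move: q q0 Aq => {}q q0 Aq.
(* The exponent [m = 2 n + 1] is chosen for this: since [s / p >= 1 / 2], the term with
   [m + 1 = 2 (n + 1)] absorbs [n] and leaves [-1]. *)
have step1 : (2 * N + 1) * q * (N - p) - (2 * N + 1) * (2 * (N + 1)) * (q / p) * s
    <= - (q * (1 + p)).
  have sp : 2^-1 <= s / p by rewrite ler_pdivlMr// mulrC.
  have -> : (2 * N + 1) * q * (N - p) - (2 * N + 1) * (2 * (N + 1)) * (q / p) * s =
     ((2 * N + 1) * q) * (N - p - 2 * (N + 1) * (s / p)) by field; rewrite gt_eqF.
  have H : N - p - 2 * (N + 1) * (s / p) <= - (1 + p).
    have : (N + 1) <= 2 * (N + 1) * (s / p) by nra.
    lra.
  apply: (@le_trans _ _ ((2 * N + 1) * q * - (1 + p))).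
    by rewrite ler_pM2l// mulr_gt0// ltr_wpDl// mulr_ge0.
  have := mulr_ge0 N0 (mulr_ge0 (ltW q0) (ltW p0)); have := mulr_ge0 N0 (ltW q0); lra.
have step2 : A * ((2 * N + 1) * q * (N - p) - (2 * N + 1) * (2 * (N + 1)) * (q / p) * s)
    <= A * - (q * (1 + p)) by rewrite ler_pM2l.
apply: le_lt_trans (lerD (lexx _) step2) _.
(* For large [p] the product [(N - p) (p + g) <= - 4 p] suffices; for small [p] the multiple of [A]
   does. *)
have [pN|pN] := leP (N + 4) p.
  have H1 : 0 <= A * (q * (1 + p)) by rewrite mulr_ge0 ?(ltW A0)// mulr_ge0 ?addr_ge0// ltW.
  have H2 : (N - p) * (p + g) <= - 4 * p by clear -pN g0 p0 N0; nra.
  rewrite mulrN; clear -H1 H2 pN N0; lra.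
have {}Aq := Aq pN.
have H2 : 0 <= A * q * p by rewrite !mulr_ge0 ?(ltW A0) ?(ltW q0) ?(ltW p0).
have H3 : (N - p) * (p + g) <= 3 * N * p.
  have [Np|Np] := leP p N; clear -Np N0 p0 g0 gp; nra.
have -> : A * - (q * (1 + p)) = - (A * q) - A * q * p by ring.
move: (A * q) (A * q * p) Aq H2 => a b Aq H2.
clear -Aq H2 H3 pN N0 p0; nra.
Qed.
End Barrier.

(** * The maximum principle argument *)

Section Liouville.
Context {R : realType} {n : nat}.

(* The rows of [P] form an orthonormal frame for the metric [D^2 f]; the four sums
   are the traces of [D^2 f] and [D^2 psi] and the products [<df, dpsi>] and
   [|dpsi|^2] with respect to this metric. *)
Definition soliton_frame (f psi S : 'rV[R]_n -> R) (s : 'rV[R]_n) : Prop :=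
  exists (P : 'M[R]_n) (f1 f2 p1 p2 : 'I_n -> R),
  [/\ forall k, jet2 (fun t => f (s + t *: row k P)) (f s) (f1 k) (f2 k),
      forall k, jet2 (fun t => psi (s + t *: row k P)) (psi s) (p1 k) (p2 k),
      \sum_k f2 k = n%:R, \sum_k p2 k = n%:R + S s - psi s &
      \sum_k f1 k * p1 k = psi s /\ \sum_k p1 k ^+ 2 = S s].

(** The function [W] of the header, with [m = 2 n + 1]. *)
Definition barrier (f psi : 'rV[R]_n -> R) (s : 'rV[R]_n) : R :=
  psi s * f s - barrier_const n * psi s ^- (2 * n).+1 + f s - \sum_i s 0 i.

Definition penalized (c eps : R) (f psi : 'rV[R]_n -> R) (s : 'rV[R]_n) : R :=
  c * (psi s - f s) - eps * barrier f psi s.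

Lemma jet2_penalized (c eps : R) (f psi : 'rV[R]_n -> R) (s v : 'rV[R]_n) (f1 f2 p1 p2 : R) :
  (forall s, 0 < psi s) ->
  jet2 (fun t => f (s + t *: v)) (f s) f1 f2 ->
  jet2 (fun t => psi (s + t *: v)) (psi s) p1 p2 ->
  jet2 (fun t => penalized c eps f psi (s + t *: v)) (penalized c eps f psi s)
    (c * (p1 - f1) - eps * (psi s * f1 + f s * p1
      + barrier_const n * ((2 * n).+1%:R * psi s ^- (2 * n).+2 * p1)
      + f1 - \sum_i v 0 i))
    (c * (p2 - f2) - eps * (psi s * f2 + f s * p2 + 2 * p1 * f1
      - barrier_const n * ((2 * n).+1%:R * (2 * n).+2%:R * psi s ^- (2 * n).+3 * p1 ^+ 2
                          - (2 * n).+1%:R * psi s ^- (2 * n).+2 * p2)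
      + f2)).
Proof.
move=> psi0 fj pj.
have ej := jet2_expN (2 * n).+1 (fun t => psi0 (s + t *: v)) pj.
have lj := jet2_affine (\sum_i s 0 i) (\sum_i v 0 i).
have bj := jet2D (jet2D (jet2D (jet2M pj fj) (jet2Z (- barrier_const n) ej)) fj)
   (jet2Z (-1) lj).
have := jet2D (jet2Z c (jet2D pj (jet2Z (-1) fj))) (jet2Z (- eps) bj).
rewrite (_ : (fun t => _) = (fun t => penalized c eps f psi (s + t *: v))); last first.
  apply/funext => t; rewrite /penalized /barrier.
  under [in RHS]eq_bigr do rewrite !mxE.
  by rewrite big_split/= -mulr_sumr; ring.
by move/jet2_eq; apply; rewrite ?/penalized ?/barrier; ring.
Qed.

(** At a local maximum the derivative along [(1, ..., 1)] vanishes and the second derivatives along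
    the frame are nonpositive, so [L] of the penalized function is nonpositive. As
    [L (psi - f) = 0], this value is [- eps L W], which is positive by [barrier_neg]. *)
Lemma penalized_no_max (c eps : R) (f psi S : 'rV[R]_n -> R) (s : 'rV[R]_n) : 0 < eps ->
  (forall s, 0 < psi s) -> 0 <= f s -> f s <= 2 * psi s -> psi s / 2 <= S s ->
  soliton_frame f psi S s ->
  (exists f2, jet2 (fun t => f (s + t *: const_mx 1)) (f s) (psi s) f2) ->
  (exists p2, jet2 (fun t => psi (s + t *: const_mx 1)) (psi s) (S s) p2) ->
  ~ (\forall y \near s, penalized c eps f psi y <= penalized c eps f psi s).
Proof.
move=> eps0 psi0 fs0 fp pS [P [f1 [f2 [p1 [p2 [fj pj f2E p2E [fpE ppE]]]]]]].
move=> [f2' fj'] [p2' pj'] smax.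
have line v : \forall t \near (0 : R),
    penalized c eps f psi (s + t *: v) <= penalized c eps f psi (s + 0 *: v).
  have : {for (0 : R), continuous (fun t : R => s + t *: v)}.
    apply: continuousD; first exact: cst_continuous.
    exact: scalel_continuous.
  rewrite scale0r addr0.
  move=> /(_ [set y | penalized c eps f psi y <= penalized c eps f psi s]%classic).
  by rewrite scale0r addr0; apply.
have [D1 _] := jet2_max (jet2_penalized c eps psi0 fj' pj') (line _).
have Dk k := (jet2_max (jet2_penalized c eps psi0 (fj k) (pj k)) (line _)).2.
have := @sumr_le0 _ _ (index_enum 'I_n) xpredT _ (fun k _ => Dk k).
have := barrier_neg n (psi0 s) fs0 fp pS.
have sum1 : \sum_i (const_mx 1 : 'rV[R]_n) 0 i = n%:R.
  by under eq_bigr do rewrite mxE; rewrite sumr_const card_ord.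
rewrite sum1 in D1.
set B := barrier_const n; set M1 := (2 * n).+1%:R; set M2 := (2 * n).+2%:R.
set q1 := psi s ^- (2 * n).+2; set q2 := psi s ^- (2 * n).+3.
(* The second derivatives are regrouped so that their sum involves only the four quantities
   prescribed by the frame. *)
rewrite (eq_bigr (fun k => (c - eps * f s - eps * B * M1 * q1) * p2 k
    + (- c - eps * psi s - eps) * f2 k
    + (- 2 * eps) * (f1 k * p1 k) + eps * B * M1 * M2 * q2 * p1 k ^+ 2)); last first.
  by move=> k _; rewrite /B /M1 /M2 /q1 /q2; ring.
rewrite !big_split/= -!mulr_sumr p2E f2E fpE ppE => bneg Dsum.
move: D1; rewrite -/B -/M1 -/q1 => D1.
have : - eps * ((n%:R - psi s) * (psi s + f s) + psi s + 2 * n%:R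
  + B * (M1 * q1 * (n%:R - psi s) - M1 * M2 * q2 * S s)) <= 0.
  (* Subtracting the vanishing first derivative turns the trace into [L]. *)
  move: Dsum; rewrite -[leLHS]subr0 -D1; apply: le_trans; rewrite le_eqVlt; apply/orP; left.
  apply/eqP; ring.
by rewrite mulNr oppr_le0 pmulr_rge0// leNgt bneg.
Qed.

Lemma continuous_penalized (c eps : R) (f psi : 'rV[R]_n -> R) :
  continuous f -> continuous psi -> (forall s, 0 < psi s) ->
  continuous (penalized c eps f psi).
Proof.
move=> fc pc p0 s; rewrite /penalized /barrier.
have sumc : continuous (fun s : 'rV[R]_n => \sum_i s 0 i).
  by apply: continuous_sum => i; exact: coord_continuous.
have powc : {for s, continuous (fun s => psi s ^- (2 * n).+1)}.
  apply: continuousV; first by rewrite expf_neq0// gt_eqF.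
  apply: (@continuous_comp _ _ _ psi (fun x => x ^+ (2 * n).+1)); first exact: pc.
  exact: exprn_continuous.
have cc (k : R) : {for s, continuous (fun _ : 'rV[R]_n => k)} by exact: cst_continuous.
have h1 := continuousM (cc c) (continuousB (pc s) (fc s)).
have h2 := continuousB (continuousM (pc s) (fc s)) (continuousM (cc (barrier_const n)) powc).
exact: (continuousB h1 (continuousM (cc eps) (continuousB (continuousD h2 (fc s)) (sumc s)))).
Qed.

(** The last two hypotheses confine the superlevel sets of the penalized function in [psi >= a] to
    compact sets. A maximum is thus attained, and [penalized_no_max] forces it onto [psi = a], where
    [|psi - f| <= a]. *)
Theorem soliton_liouville (f psi S : 'rV[R]_n -> R) :
  continuous f -> continuous psi ->
  (forall s, 0 < psi s) -> (forall s, 0 <= f s) -> (forall s, f s <= 2 * psi s) ->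
  (forall s, psi s / 2 <= S s) ->
  (forall s, soliton_frame f psi S s) ->
  (forall s, exists f2, jet2 (fun t => f (s + t *: const_mx 1)) (f s) (psi s) f2) ->
  (forall s, exists p2, jet2 (fun t => psi (s + t *: const_mx 1)) (psi s) (S s) p2) ->
  (exists C : R, forall s : 'rV[R]_n, \sum_i `|s 0 i| <= f s - \sum_i s 0 i + C) ->
  (forall C : R, exists K : R, forall s, f s <= C -> psi s <= K) ->
  forall s, psi s = f s.
Proof.
move=> fc pc p0 f0 fp pS frame fj pj [C fC] pK.
(* The values [c = 1] and [c = -1] give the two inequalities. *)
suff main (c : R) (s0 : 'rV[R]_n) : `|c| <= 1 -> c * (psi s0 - f s0) <= 0.
  move=> s; apply/eqP; rewrite -subr_eq0 eq_le; apply/andP; split.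
    by have := main 1 s; rewrite normr1 mul1r; apply.
  by have := main (-1) s; rewrite normrN1 mulN1r oppr_le0; apply.
move=> c1.
have osc s : c * (psi s - f s) <= psi s.
  apply: (le_trans (ler_norm _)); rewrite normrM -[leRHS]mul1r ler_pM// ler_norml.
  by have := f0 s; have := fp s; move=> ? ?; apply/andP; split; lra.
apply/ler_addgt0Pr => a a0; rewrite add0r.
have [pa|ap] := leP (psi s0) a; first exact: le_trans (osc s0) pa.
(* Bound for the singular term of the barrier on [psi >= a]. *)
pose B := barrier_const n * a ^- (2 * n).+1.
have barrier_ge s : a <= psi s -> psi s * f s - B + f s - \sum_i s 0 i <= barrier f psi s.
  move=> aps; rewrite /barrier lerD2r lerD2r lerD2l lerN2 ler_pM2l ?barrier_const_gt0//.
  by rewrite lef_pV2 ?posrE ?exprn_gt0// ler_pXn2r// nnegrE ltW.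
have C0 s : - C <= f s - \sum_i s 0 i.
  have S0 : 0 <= \sum_i `|s 0 i| by apply: sumr_ge0 => i _.
  by rewrite -[leLHS]sub0r lerBlDr (le_trans S0 (fC s)).
have pf0 s : 0 <= psi s * f s by rewrite mulr_ge0// ltW.
apply/ler_addgt0Pr => e e0.
(* Comparing [s0] with the maximum point will give the bound [a + eps X]; [eps] is chosen so that
   [eps X <= e]. *)
pose X := barrier f psi s0 + B + C.
have X0 : 0 <= X.
  have := barrier_ge s0 (ltW ap); have := C0 s0; have := pf0 s0.
  rewrite /X; lra.
pose eps := e / (X + 1).
have eps0 : 0 < eps by rewrite divr_gt0// ltr_wpDl.
pose G := penalized c eps f psi.
pose Z : set 'rV[R]_n := [set s | a <= psi s /\ G s0 <= G s]%classic.
have Gc : continuous G by exact: continuous_penalized.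
have Zc : closed Z.
  apply: (@closedI _ (psi @^-1` [set x | a <= x])%classic (G @^-1` [set x | G s0 <= x])%classic).
    by apply: preimage_closed => [x _|]; [exact: pc|exact: closed_ge].
  by apply: preimage_closed => [x _|]; [exact: Gc|exact: closed_ge].
have [K fK] := pK eps^-1.
have Zb : bounded_set Z.
  pose M := (`|K| + eps * B - G s0) / eps + C.
  exists M; split; first exact: num_real.
  move=> M' MM' s [aps Gs]; apply: le_trans (ltW MM').
  have sM : \sum_i `|s 0 i| <= M.
    apply: (le_trans (fC s)); rewrite lerD2r ler_pdivlMr// mulrC.
    (* Where [f <= 1 / eps], [psi] is bounded by [K]; elsewhere the product is nonpositive, because
       the term [psi f] of the barrier dominates [psi]. *)
    have H1 : psi s * (1 - eps * f s) <= `|K|.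
      have [fe|fe] := leP (f s) eps^-1.
        apply: le_trans (ler_norm K); apply: le_trans (fK s fe).
        by rewrite ler_piMr ?(ltW (p0 s))// gerBl mulr_ge0// ltW.
      apply: (@le_trans _ _ 0) => //; rewrite pmulr_rle0// subr_le0.
      by rewrite -ler_pdivrMl// mulr1 ltW.
    move: Gs; rewrite [G s]/G/penalized => Gs.
    have := barrier_ge s aps; rewrite -(ler_pM2l eps0) => H2.
    have := osc s; move: H1 H2 Gs; rewrite !(mulrBr, mulrDr, mulr1) mulrCA; lra.
  apply: ler_norm_coord => [|i].
    by apply: le_trans sM; apply: sumr_ge0.
  by apply: le_trans sM; rewrite (bigD1 i)//= lerDl sumr_ge0.
have [|s sZ smax] := EVT_max_rV _ (bounded_closed_compact Zb Zc) (continuous_subspaceT Gc).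
  by exists s0; split => //; exact: ltW.
move: sZ; rewrite inE => -[aps Gs].
(* If [psi s > a], nearby points satisfy the constraint of [Z], so the maximum over [Z] is a local
   maximum. *)
have psa : psi s <= a.
  rewrite leNgt; apply/negP => aps'.
  apply: (penalized_no_max eps0 p0 (f0 s) (fp s) (pS s) (frame s) (fj s) (pj s)).
  have : \forall y \near s, a < psi y by apply: (cvgr_gt _ (pc s)).
  apply: filterS => y ay; have [Gy|Gy] := leP (G s0) (G y).
    by apply: smax; rewrite inE; split => //; exact: ltW.
  exact: le_trans (ltW Gy) Gs.
have H1 : G s <= a + eps * (B + C).
  rewrite /G /penalized; have := le_trans (osc s) psa.
  have : - (B + C) <= barrier f psi s.
    have := barrier_ge s aps; have := C0 s; have := pf0 s; lra.
  rewrite -(ler_pM2l eps0) mulrN; lra.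
have H2 : c * (psi s0 - f s0) = G s0 + eps * barrier f psi s0.
  by rewrite /G /penalized subrK.
have H3 : eps * X <= e.
  rewrite /eps mulrAC ler_pdivrMr ?ltr_wpDl//.
  by rewrite ler_wpM2l ?(ltW e0)// lerDl.
rewrite H2; move: H3; rewrite /X !mulrDr => H3.
move: H1; rewrite mulrDr => H1.
lra.
Qed.
End Liouville.

(** * Positive definite matrices and orthonormal frames *)

Section PositiveDefinite.
Context {R : realType}.

Definition quadform n (A : 'M[R]_n) (x : 'rV[R]_n) : R := (x *m A *m x^T) 0 0.

(** If the form vanishes at [x], put [y = x A]: its value at [x - t y] is [t^2 q(y) - 2 t |y|^2],
    and nonnegativity for small [t > 0] forces [y = 0], hence [x = 0] by invertibility. *)
Lemma psd_unit_pd n (A : 'M[R]_n) : A^T = A -> A \in unitmx ->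
  (forall x, 0 <= quadform A x) -> forall x, x != 0 -> 0 < quadform A x.
Proof.
move=> As Au Apsd x x0; rewrite lt_neqAle Apsd andbT eq_sym.
apply/negP => /eqP qx0; move/eqP: x0; apply.
pose y := x *m A; pose N := (y *m y^T) 0 0.
have expand (t : R) : quadform A (x - t *: y) = t ^+ 2 * quadform A y - 2 * t * N.
  have -> : quadform A (x - t *: y) = quadform A x - t * (x *m A *m y^T) 0 0
      - t * (y *m A *m x^T) 0 0 + t ^+ 2 * quadform A y.
    rewrite /quadform (_ : (x - t *: y)^T = x^T - t *: y^T); last by rewrite linearB/= linearZ.
    rewrite mulmxBl mulmxBr !mulmxBl -!scalemxAl -!scalemxAr.
    by rewrite !mxE; ring.
  have -> : (y *m A *m x^T) 0 0 = N.
    by rewrite /N [in RHS]/y trmx_mul As mulmxA.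
  by rewrite -/y -/N qx0; ring.
have NE : N = \sum_i y 0 i ^+ 2.
  by rewrite /N [LHS]mxE; apply: eq_bigr => i _; rewrite [y^T i 0]mxE expr2.
have N0 : N <= 0.
  apply/ler_addgt0Pr => e e0; rewrite add0r.
  have q0 := Apsd y; pose t := e / (quadform A y + 1).
  have t0 : 0 < t by rewrite divr_gt0// ltr_wpDl.
  have := Apsd (x - t *: y); rewrite expand.
  have -> : t ^+ 2 * quadform A y - 2 * t * N = t * (t * quadform A y - 2 * N) by ring.
  rewrite pmulr_rge0// subr_ge0.
  have : t * quadform A y <= e.
    by rewrite /t mulrAC ler_pdivrMr ?ltr_wpDl// ler_wpM2l ?(ltW e0)// lerDl.
  lra.
have y0 : y = 0.
  apply/rowP => i; rewrite [RHS]mxE; apply/eqP; rewrite -sqrf_eq0; apply/eqP.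
  apply: (@psumr_eq0P _ _ predT (fun i => y 0 i ^+ 2)) => //; first by move=> j _; exact: sqr_ge0.
  by apply/eqP; rewrite eq_le -NE N0 NE sumr_ge0// => j _; exact: sqr_ge0.
by rewrite -[x](mulmxK Au) -/y y0 mul0mx.
Qed.

(** Induction on the size: [L] clears the first row and column, leaving the pivot [a] and the Schur
    complement [D'], which is again symmetric and positive definite. The pivot is normalized by
    [1 / sqrt a]. *)
Lemma pd_frame n (A : 'M[R]_n) : A^T = A -> (forall x, x != 0 -> 0 < quadform A x) ->
  exists P : 'M[R]_n, P *m A *m P^T = 1%:M.
Proof.
elim: n A => [|n IH] A As Apd; first by exists 1%:M; apply/matrixP => -[].
pose B : 'M[R]_(1 + n) := A.
pose a : R := ulsubmx B 0 0; pose r := ursubmx B; pose D := drsubmx B.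
have aE : ulsubmx B = a%:M by rewrite [LHS]mx11_scalar.
have cE : dlsubmx B = r^T by rewrite /r trmx_ursub [B^T]As.
have DE : D^T = D by rewrite /D trmx_drsub [B^T]As.
have BE : B = block_mx a%:M r r^T D by rewrite -aE -cE submxK.
have a0 : 0 < a.
  have -> : a = quadform B (row_mx 1%:M 0).
    rewrite /quadform BE mul_row_block tr_row_mx mul_row_col !mul1mx !mul0mx !addr0.
    by rewrite trmx1 mulmx1 trmx0 mulmx0 addr0 mxE eqxx.
  apply: Apd; apply/eqP => /(congr1 (@lsubmx R 1 1 n)); rewrite row_mxKl.
  by move/matrixP/(_ 0 0); rewrite !mxE eqxx => /eqP; rewrite oner_eq0.
pose k := a^-1 *: r^T; pose L := block_mx 1%:M 0 (- k) 1%:M : 'M[R]_(1 + n).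
pose D' := D - k *m r.
have ka : k *m a%:M = r^T by rewrite /k mul_mx_scalar scalerA mulfV ?gt_eqF// scale1r.
have LE : L *m B *m L^T = block_mx a%:M 0 0 D'.
  rewrite BE /L mulmx_block !mul1mx !mul0mx !addr0 mulNmx ka addNr mulNmx.
  rewrite tr_block_mx mulmx_block !trmx1 trmx0 !mulmx0 !mulmx1 !mul0mx !addr0 !add0r.
  rewrite linearN/= mulmxN -[a%:M *m _]trmxK trmx_mul trmxK tr_scalar_mx ka trmxK addNr.
  by rewrite addrC.
have D's : D'^T = D'.
  by rewrite /D' linearB/= DE trmx_mul /k linearZ/= trmxK -scalemxAl -scalemxAr.
have D'pd y : y != 0 -> 0 < quadform D' y.
  move=> y0; have -> : quadform D' y = quadform B (row_mx 0 y *m L).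
    rewrite /quadform trmx_mul !mulmxA -(mulmxA _ _ B) -(mulmxA _ _ L^T) LE.
    by rewrite mul_row_block tr_row_mx mul_row_col !mul0mx !mulmx0 !add0r trmx0 mulmx0 add0r.
  apply: Apd; apply/eqP; rewrite /L mul_row_block => /(congr1 (@rsubmx R 1 1 n)).
  rewrite row_mxKr mul0mx add0r mulmx1 => E; move: y0; rewrite E.
  by rewrite (_ : rsubmx _ = 0) ?eqxx//; apply/matrixP => i j; rewrite !mxE.
have [P' P'E] := IH _ D's D'pd.
pose c := (Num.sqrt a)^-1.
pose Q : 'M[R]_(1 + n) := block_mx c%:M 0 0 P'.
exists (Q *m L); rewrite trmx_mul !mulmxA -(mulmxA _ L B) -(mulmxA _ _ L^T).
have QT : Q^T = block_mx c%:M 0 0 P'^T.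
  by rewrite [LHS](@tr_block_mx _ 1 n 1 n) tr_scalar_mx !trmx0.
have Q1 : Q *m block_mx a%:M 0 0 D' *m block_mx c%:M 0 0 P'^T = 1%:M.
  rewrite /Q !(@mulmx_block _ 1 n 1 n 1 n).
  rewrite !(mul0mx, mulmx0) !(addr0, add0r, mul0mx, mulmx0) P'E.
  rewrite -!scalar_mxM [RHS](@scalar_mx_block _ 1 n); congr block_mx; congr (_%:M).
  by rewrite /c mulrAC -invfM -expr2 sqr_sqrtr ?(ltW a0)// mulVf// gt_eqF.
by rewrite LE QT.
Qed.
End PositiveDefinite.

(** * Derivative of a determinant *)

Section Determinant.
Context {R : realType}.

Lemma is_derive_bigsum (V : normedModType R) (I : Type) (r : seq I) (F : I -> V -> R)
    (dF : I -> R) (x v : V) :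
  (forall i, is_derive x v (F i) (dF i)) ->
  is_derive x v (fun x => \sum_(i <- r) F i x) (\sum_(i <- r) dF i).
Proof.
move=> Fd; elim: r => [|a r IH].
  by under eq_fun do rewrite big_nil; rewrite big_nil; exact: is_derive_cst.
under eq_fun do rewrite big_cons; rewrite big_cons.
exact: (is_deriveD (Fd a) IH).
Qed.

(** Leibniz rule; [uniq] ensures that the condition [j != i] removes exactly one factor. *)
Lemma is_derive_prod (I : eqType) (r : seq I) (F : I -> R -> R) (dF : I -> R) (t : R) :
  uniq r -> (forall i, is_derive t 1 (F i) (dF i)) ->
  is_derive t 1 (fun x => \prod_(i <- r) F i x)
    (\sum_(i <- r) dF i * \prod_(j <- r | j != i) F j t).
Proof.
move=> + Fd; elim: r => [_|a r IH /= /andP[ar ur]].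
  by under eq_fun do rewrite big_nil; rewrite big_nil; exact: is_derive_cst.
have -> : (fun x => \prod_(i <- a :: r) F i x) = (fun x => F a x * \prod_(i <- r) F i x).
  by apply/funext => x; rewrite big_cons.
apply: is_derive_eq (is_deriveM (Fd a) (IH ur)) _.
rewrite /GRing.scale/= big_cons addrC; congr (_ + _).
  rewrite mulrC big_cons eqxx/=; congr (_ * _).
  rewrite big_seq [RHS]big_seq_cond; apply: eq_bigl => j.
  by case: (boolP (j \in r)) => //= jr; apply/esym; apply: contraNneq ar => <-.
rewrite mulr_sumr; apply: eq_big_seq => i ir.
rewrite big_cons (_ : a != i) 1?mulrCA//.
by apply: contraNneq ar => ->.
Qed.

(** Only the identity permutation contributes. Any other one moves at least two indices, so after
    differentiating one factor an off-diagonal entry of the identity matrix remains. *)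
Lemma is_derive_det1 n (B : R -> 'M[R]_n) (dB : 'M[R]_n) (t : R) :
  (forall i j, is_derive t 1 (fun x => B x i j) (dB i j)) -> B t = 1%:M ->
  is_derive t 1 (fun x => \det (B x)) (\tr dB).
Proof.
move=> Bd B1.
have H (s : 'S_n) : is_derive t 1 (fun x => (-1) ^+ s * \prod_i B x i (s i))
    ((-1) ^+ s * \sum_i (dB i (s i) * \prod_(j | j != i) B t j (s j))).
  apply: is_deriveZ; apply: (@is_derive_prod _ _ (fun i x => B x i (s i))).
  exact: index_enum_uniq.
apply: is_derive_eq (is_derive_bigsum _ H) _.
rewrite (bigD1 (1%g : {perm _}))//= odd_perm1 expr0 mul1r [X in _ + X]big1 ?addr0.
  rewrite /mxtrace; apply: eq_bigr => i _; rewrite big1 ?mulr1 ?perm1// => j _.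
  by rewrite B1 perm1 mxE eqxx.
move=> s s1; rewrite big1 ?mulr0// => i _.
have [j ji sj] : exists2 j, j != i & s j != j.
  apply/exists_inP; apply: contraNT s1 => /exists_inPn H1; apply/eqP/permP => j.
  rewrite perm1; have [->|ji] := eqVneq j i; last by move: (H1 j ji); rewrite negbK => /eqP.
  have [//|si] := eqVneq (s i) i; move: (H1 _ si); rewrite negbK => /eqP/perm_inj.
  by move/eqP; rewrite (negPf si).
by rewrite (bigD1 j)//= B1 mxE eq_sym (negPf sj) mul0r mulr0.
Qed.

(* Jacobi's formula [(det A)' = det A * tr (A^-1 A')], with [A^-1 = P^T P]. *)
Lemma trace_frame n (A : R -> 'M[R]_n) (dA P : 'M[R]_n) (t l : R) :
  (forall i j, is_derive t 1 (fun x => A x i j) (dA i j)) ->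
  P *m A t *m P^T = 1%:M ->
  is_derive t 1 (fun x => \det (A x)) (\det (A t) * l) ->
  \tr (P *m dA *m P^T) = l.
Proof.
move=> Ad PA detd.
have H1 : is_derive t 1 (fun x => \det (P *m A x *m P^T)) (\tr (P *m dA *m P^T)).
  apply: is_derive_det1 => // i j.
  have rowd k : is_derive t 1 (fun x => (P *m A x) i k) ((P *m dA) i k).
    rewrite mxE; under eq_fun do rewrite mxE.
    by apply: is_derive_bigsum => l'; apply: is_deriveZ; exact: Ad.
  rewrite mxE; under eq_fun do rewrite mxE.
  apply: is_derive_bigsum => k; rewrite mulrC.
  under eq_fun do rewrite mulrC.
  by apply: is_deriveZ; exact: rowd.
have H2 : is_derive t 1 (fun x => \det (P *m A x *m P^T)) l.
  have -> : (fun x => \det (P *m A x *m P^T)) = (fun x => \det P ^+ 2 * \det (A x)).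
    by apply/funext => x; rewrite !det_mulmx det_tr; ring.
  apply: is_derive_eq (is_deriveZ (\det P ^+ 2) detd) _.
  have := congr1 determinant PA; rewrite !det_mulmx det_tr det1 /GRing.scale/= => E.
  by rewrite mulrA (_ : \det P ^+ 2 * \det (A t) = 1) ?mul1r// -E; ring.
by have [_ <-] := H1; have [_ <-] := H2.
Qed.
End Determinant.

(** * Logarithmic coordinates on the real positive slice *)

Section LogCoordinates.
Context {R : realType} {n : nat}.
Implicit Types (F : 'rV[R]_(n + n) -> R) (s v : 'rV[R]_n) (i j : 'I_n).

(** The point with [z_i = e^(s_i / 2)] real and positive. Every torus orbit off the coordinate
    hyperplanes meets the slice. *)
Definition slice s : 'rV[R]_(n + n) := row_mx (\row_i expR (s 0 i / 2)) 0.

(* The vector field [d/ds_i] in the coordinates [s_i = ln |z_i|^2] of the slice. *)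
Definition euler i F : 'rV[R]_(n + n) -> R :=
  fun x => 2^-1 * (x 0 (lshift n i) * partial (lshift n i) F x).

Lemma slicel s i : slice s 0 (lshift n i) = expR (s 0 i / 2).
Proof. by rewrite row_mxEl mxE. Qed.

Lemma slicer s i : slice s 0 (rshift n i) = 0.
Proof. by rewrite row_mxEr mxE. Qed.

Lemma smooth_euler i F : smooth F -> smooth (euler i F).
Proof.
move=> Fs; apply: smooth_closureP; apply/closure_scale/closure_coord/closure_smooth.
exact: smooth_partial.
Qed.

Lemma smooth_sum (I : Type) (r : seq I) (c : I -> R) (F : I -> 'rV[R]_(n + n) -> R) :
  (forall k, smooth (F k)) -> smooth (fun x => \sum_(k <- r) c k * F k x).
Proof.
move=> Fs; apply: smooth_closureP; elim: r => [|k r IH].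
  under eq_fun do rewrite big_nil.
  rewrite (_ : (fun _ => 0) = (fun x => 0 * (fun _ => 0 : R) x)); last first.
    by apply/funext => x; rewrite mulr0.
  apply: closure_scale; apply: closure_smooth.
  apply: (@smooth_coind _ _ (fun g => exists c : R, g = cst c)); last by exists 0.
  move=> _ [a ->]; split=> [|i x|i]; first exact: cst_continuous.
    exact: derivable_cst.
  by exists 0; apply/funext => x; rewrite /partial derive_cst.
under eq_fun do rewrite big_cons.
by apply: closure_add => //; apply/closure_scale/closure_smooth.
Qed.

Lemma is_derive_slice F s v (t : R) : smooth F ->
  is_derive t 1 (fun t => F (slice (s + t *: v)))
    (\sum_i v 0 i * euler i F (slice (s + t *: v))).
Proof.
move=> Fs.
pose dc : 'rV[R]_(n + n) :=
  row_mx (\row_i (v 0 i * (2^-1 * expR ((s + t *: v) 0 i / 2)))) 0.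
have := @smooth_comp_derive _ _ F (fun t => slice (s + t *: v)) t dc Fs _.
have H (k : 'I_(n + n)) : is_derive t 1 (fun t => slice (s + t *: v) 0 k) (dc 0 k).
  case: (split_ordP k) => i ->.
    under eq_fun do rewrite slicel !mxE mulrDl.
    rewrite /dc row_mxEl !mxE mulrDl.
    have lin : is_derive t 1 (fun t => s 0 i / 2 + t * v 0 i / 2) (v 0 i / 2).
      by apply: is_derive_eq; rewrite /GRing.scale/=; ring.
    by have D := is_derive1_comp (is_derive_expR _) lin; apply: is_derive_eq D _; ring.
  under eq_fun do rewrite slicer.
  by rewrite /dc row_mxEr mxE; exact: is_derive_cst.
move/(_ H) => D; apply: is_derive_eq D _.
rewrite big_split_ord/= [X in _ + X]big1 ?addr0 => [|i _]; last first.
  by rewrite /dc row_mxEr mxE mul0r.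
apply: eq_bigr => i _; rewrite /dc row_mxEl mxE /euler slicel; ring.
Qed.

(** The diagonal first-order term comes from differentiating the coordinate factor of [euler j]. *)
Lemma eulerE i j F x : smooth F -> euler i (euler j F) x =
  4^-1 * (x 0 (lshift n i) * x 0 (lshift n j) * partial (lshift n i) (partial (lshift n j) F) x)
  + (i == j)%:R * (2^-1 * euler j F x).
Proof.
move=> Fs; rewrite /euler.
set a := lshift n i; set b := lshift n j.
have D : is_derive x (delta_mx 0 a) (fun x => 2^-1 * (x 0 b * partial b F x))
   (2^-1 * (x 0 b * partial a (partial b F) x + partial b F x * (b == a)%:R)).
  apply: is_deriveZ; apply: is_deriveM; first exact: is_derive_coord.
  by apply: derivableP; apply: smooth_derivable; exact: smooth_partial.
have [_ DE] := D; rewrite [partial a _ x]DE.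
rewrite /a /b (inj_eq (@lshift_inj _ _)) [j == i]eq_sym.
by case: eqP => [->|_] /=; field.
Qed.

Lemma eulerC i j F : smooth F -> euler i (euler j F) = euler j (euler i F).
Proof.
move=> Fs; have [->//|ij] := eqVneq i j; apply/funext => x.
rewrite (eulerE i j x Fs) (eulerE j i x Fs) (partialC _ _ Fs).
rewrite [j == i]eq_sym (negPf ij) !mul0r !addr0.
by congr (_ * (_ * _)); rewrite mulrC.
Qed.

Lemma euler_sum i (I : Type) (r : seq I) (F : I -> 'rV[R]_(n + n) -> R) x :
  (forall k, smooth (F k)) ->
  euler i (fun x => \sum_(k <- r) F k x) x = \sum_(k <- r) euler i (F k) x.
Proof.
move=> Fs; rewrite /euler -!mulr_sumr; congr (_ * (_ * _)).
have Fd k : is_derive x (delta_mx 0 (lshift n i)) (F k) (partial (lshift n i) (F k) x).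
  by apply: derivableP; exact: smooth_derivable.
have D := is_derive_bigsum r Fd.
by have [_ DE] := D; rewrite [LHS]DE.
Qed.

Lemma jet2_slice F s v : smooth F ->
  jet2 (fun t => F (slice (s + t *: v))) (F (slice s))
    (\sum_i v 0 i * euler i F (slice s))
    (\sum_i \sum_j v 0 i * v 0 j * euler j (euler i F) (slice s)).
Proof.
move=> Fs; split; first by rewrite scale0r addr0.
exists (fun t => \sum_i v 0 i * euler i F (slice (s + t *: v))) => [t|].
  exact: is_derive_slice.
split; first by rewrite scale0r addr0.
have := is_derive_bigsum (index_enum 'I_n) (fun i =>
  is_deriveZ (v 0 i) (is_derive_slice s v 0 (smooth_euler i Fs))).
move=> D; apply: is_derive_eq D _; apply: eq_bigr => i _.
by rewrite scale0r addr0 /GRing.scale/= mulr_sumr; apply: eq_bigr => j _; rewrite mulrA.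
Qed.
End LogCoordinates.

Lemma sum_delta (R : pzSemiRingType) (I : finType) (i : I) (F : I -> R) :
  \sum_j (j == i)%:R * F j = F i.
Proof.
rewrite (bigD1 i)//= eqxx mul1r big1 ?addr0// => j ji.
by rewrite (negPf ji) mul0r.
Qed.

(** * Torus invariance and the equation on the slice *)

Section Toric.
Context {R : realType} {n : nat}.
Implicit Types (u : 'rV[R]_(n + n) -> R) (x : 'rV[R]_(n + n)) (s : 'rV[R]_n) (i j : 'I_n).

(** The torus action written in real coordinates. *)
Definition rot (t : 'rV[R]_n) x : 'rV[R]_(n + n) :=
  row_mx (\row_j (cos (t 0 j) * x 0 (lshift n j) - sin (t 0 j) * x 0 (rshift n j)))
         (\row_j (cos (t 0 j) * x 0 (rshift n j) + sin (t 0 j) * x 0 (lshift n j))).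

Lemma rotl t x j :
  rot t x 0 (lshift n j) = cos (t 0 j) * x 0 (lshift n j) - sin (t 0 j) * x 0 (rshift n j).
Proof. by rewrite row_mxEl mxE. Qed.

Lemma rotr t x j :
  rot t x 0 (rshift n j) = cos (t 0 j) * x 0 (rshift n j) + sin (t 0 j) * x 0 (lshift n j).
Proof. by rewrite row_mxEr mxE. Qed.

Lemma toric_rot u t x : toric u -> u (rot t x) = u x.
Proof.
move=> ut.
pose z : 'rV[R[i]]_n := \row_j (x 0 (lshift n j) +i* x 0 (rshift n j))%C.
have -> : x = realify z.
  apply/rowP => k; rewrite /realify.
  by case: (split_ordP k) => j ->; rewrite ?row_mxEl ?row_mxEr !mxE.
rewrite [RHS](ut z t); congr u; apply/rowP => k; rewrite /rot /realify.
by case: (split_ordP k) => j ->; rewrite !(row_mxEl, row_mxEr, mxE).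
Qed.

Lemma toric_opp u x : toric u -> u (- x) = u x.
Proof.
move=> ut; rewrite -(toric_rot (const_mx pi) x ut); congr u; apply/rowP => k.
by case: (split_ordP k) => j ->; rewrite ?rotl ?rotr !mxE cospi sinpi; ring.
Qed.

(* Infinitesimal form of the invariance under the rotation of [z_i]. *)
Lemma toric_partial u i x : smooth u -> toric u ->
  x 0 (lshift n i) * partial (rshift n i) u x = x 0 (rshift n i) * partial (lshift n i) u x.
Proof.
move=> us ut.
pose c (t : R) := rot (t *: delta_mx 0 i) x.
pose dc : 'rV[R]_(n + n) := row_mx (\row_j ((j == i)%:R * - x 0 (rshift n j)))
  (\row_j ((j == i)%:R * x 0 (lshift n j))).
have cd k : is_derive (0 : R) 1 (fun t => c t 0 k) (dc 0 k).
  have cosd (a : R) : is_derive (0 : R) 1 (fun t => cos (t * a)) 0.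
    have lin : is_derive (0 : R) 1 (fun t => t * a) a.
      by apply: is_derive_eq; rewrite /GRing.scale/=; ring.
    have D := is_derive1_comp (is_derive_cos _) lin; apply: is_derive_eq D _.
    by rewrite mul0r sin0 oppr0 mul0r.
  have sind (a : R) : is_derive (0 : R) 1 (fun t => sin (t * a)) a.
    have lin : is_derive (0 : R) 1 (fun t => t * a) a.
      by apply: is_derive_eq; rewrite /GRing.scale/=; ring.
    have D := is_derive1_comp (is_derive_sin _) lin; apply: is_derive_eq D _.
    by rewrite mul0r cos0 mul1r.
  case: (split_ordP k) => j ->.
    under eq_fun do rewrite /c rotl !mxE eqxx/=.
    rewrite /dc row_mxEl mxE.
    by apply: is_derive_eq; rewrite /GRing.scale/=; ring.
  under eq_fun do rewrite /c rotr !mxE eqxx/=.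
  rewrite /dc row_mxEr mxE.
  by apply: is_derive_eq; rewrite /GRing.scale/=; ring.
have D := smooth_comp_derive us cd.
have D0 : is_derive (0 : R) 1 (fun t => u (c t)) 0.
  rewrite (_ : (fun t => u (c t)) = cst (u x)); first exact: is_derive_cst.
  by apply/funext => t; rewrite toric_rot.
have c0 : c 0 = x.
  apply/rowP => k; case: (split_ordP k) => j ->; rewrite /c ?rotl ?rotr scale0r mxE cos0 sin0; ring.
have [_ E] := D; have [_ E0] := D0; move: E; rewrite E0 c0 big_split_ord/=.
under eq_bigr do rewrite /dc row_mxEl mxE -mulrA.
under [X in _ + X]eq_bigr do rewrite /dc row_mxEr mxE -mulrA.
rewrite !sum_delta mulNr => /eqP.
by rewrite eq_sym addrC subr_eq0 => /eqP.
Qed.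

Lemma partial_coordM k l u x : smooth u ->
  partial k (fun x => x 0 l * u x) x = x 0 l * partial k u x + (k == l)%:R * u x.
Proof.
move=> us.
have D := is_deriveM (is_derive_coord l k x) (derivableP (@smooth_derivable _ _ u k x us)).
have [_ DE] := D; rewrite [LHS]DE /GRing.scale/= eq_sym; congr (_ + _); exact: mulrC.
Qed.

Lemma partial_slice_r i u s : smooth u -> toric u -> partial (rshift n i) u (slice s) = 0.
Proof.
move=> us ut; have := toric_partial i (slice s) us ut.
rewrite slicel slicer mul0r => /eqP; rewrite mulf_eq0 gt_eqF ?expR_gt0//= => /eqP //.
Qed.

(** Obtained by differentiating the identity of [toric_partial] once more, at a point whose
    imaginary coordinates are 0. *)
Lemma partial2_slice_r k j u s : smooth u -> toric u ->
  expR (s 0 j / 2) * partial k (partial (rshift n j) u) (slice s)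
  = (k == rshift n j)%:R * partial (lshift n j) u (slice s).
Proof.
move=> us ut.
have /(congr1 (fun F => partial k F (slice s))) :
    (fun x => x 0 (lshift n j) * partial (rshift n j) u x) =
    (fun x => x 0 (rshift n j) * partial (lshift n j) u x).
  by apply/funext => x; exact: toric_partial.
rewrite (partial_coordM _ _ _ (smooth_partial _ us)) (partial_coordM _ _ _ (smooth_partial _ us)).
by rewrite slicel slicer mul0r add0r (partial_slice_r j s us ut) mulr0 addr0.
Qed.

Lemma partial2_slice_r_neq k j u s : smooth u -> toric u -> k != rshift n j ->
  partial k (partial (rshift n j) u) (slice s) = 0.
Proof.
move=> us ut kj; have := partial2_slice_r k j s us ut.
rewrite (negPf kj) mul0r => /eqP; rewrite mulf_eq0 gt_eqF ?expR_gt0//= => /eqP H.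
exact: H.
Qed.

Lemma complex_hessianE u x i j : smooth u ->
  complex_hessian u x i j =
  (4^-1 * (partial (lshift n i) (partial (lshift n j) u) x
           + partial (rshift n i) (partial (rshift n j) u) x)
   +i* (4^-1 * (partial (lshift n i) (partial (rshift n j) u) x
           - partial (rshift n i) (partial (lshift n j) u) x)))%C.
Proof.
move=> us.
have half : 2^-1 = (2^-1 : R)%:C%C :> R[i] by rewrite fmorphV rmorph_nat.
have dzbarE : dzbar j (fun y => (u y)%:C%C) =
    (fun y => (2^-1 * partial (lshift n j) u y +i* (2^-1 * partial (rshift n j) u y))%C).
  apply/funext => y; rewrite /dzbar /cpartial/= half.
  have c0 k : partial k (fun=> 0) y = 0 :> R by rewrite /partial derive_cst.
  have -> : (fun y => u y) = u by [].
  rewrite !c0; apply/eqP; rewrite eq_complex/=; apply/andP.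
  move: (partial (lshift n j) u y) (partial (rshift n j) u y) => a b.
  by split; apply/eqP; ring.
have D k l y : partial k (fun x => 2^-1 * partial l u x) y = 2^-1 * partial k (partial l u) y.
  have [_ DE] := is_deriveZ 2^-1 (derivableP (@smooth_derivable _ _ _ k y (smooth_partial l us))).
  by rewrite [LHS]DE.
rewrite mxE dzbarE /dz /cpartial/= !D half.
move: (partial (lshift n i) (partial (lshift n j) u) x)
  (partial (rshift n i) (partial (rshift n j) u) x)
  (partial (lshift n i) (partial (rshift n j) u) x)
  (partial (rshift n i) (partial (lshift n j) u) x) => a b c d.
by apply/eqP; rewrite eq_complex/=; apply/andP; split; apply/eqP; field.
Qed.

(* On the slice, [d_i d_j phi = z_i z_j d^2 u / dz_i dzbar_j] for a toric [u]. *)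
Definition hessian_slice u s : 'M[R]_n := \matrix_(i, j) euler i (euler j u) (slice s).

(** On the slice the mixed real-imaginary derivatives vanish, so the complex Hessian is a real
    matrix [M]. Multiplying it on both sides by the diagonal matrix of the [e^(s_i / 2)] gives the
    Hessian in [s] and contributes the factor [e^(sum_i s_i)]. *)
Lemma det_hessian_slice u s : smooth u -> toric u -> is_solution u ->
  \det (hessian_slice u s) =
  expR (\sum_i s 0 i + \sum_i euler i u (slice s) - u (slice s)).
Proof.
move=> us ut usol; set x := slice s.
pose D : 'rV[R]_n := \row_i expR (s 0 i / 2).
pose M : 'M[R]_n := \matrix_(i, j)
  (4^-1 * (partial (lshift n i) (partial (lshift n j) u) x
         + partial (rshift n i) (partial (rshift n j) u) x)).
have HM : complex_hessian u x = map_mx (real_complex R) M.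
  apply/matrixP => i j; rewrite (complex_hessianE x i j us) !mxE.
  have E1 : partial (lshift n i) (partial (rshift n j) u) x = 0.
    by apply: (partial2_slice_r_neq s us ut); rewrite eq_lrshift.
  have E2 : partial (rshift n i) (partial (lshift n j) u) x = 0.
    rewrite (partialC (rshift n i) (lshift n j) us).
    by apply: (partial2_slice_r_neq s us ut); rewrite eq_lrshift.
  rewrite E1 E2 subrr mulr0; move: (4^-1 * _) => a; exact: erefl.
have HD : hessian_slice u s = diag_mx D *m M *m diag_mx D.
  apply/matrixP => i j; rewrite mul_diag_mx mul_mx_diag !mxE (eulerE i j _ us) !slicel.
  (* For [i = j] the second derivative in the imaginary direction supplies the first-order term of
     [eulerE]; for [i != j] it vanishes. *)
  have := partial2_slice_r (rshift n i) j s us ut; rewrite (inj_eq (@rshift_inj _ _)) -/x => E.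
  rewrite /euler slicel -/x.
  case: eqP E => [->|_]; rewrite ?mul1r ?mul0r => E; last first.
    move/eqP: E; rewrite mulf_eq0 gt_eqF ?expR_gt0//= => /eqP ->.
    move: (expR _) (expR _) (partial _ (partial (lshift n j) u) x) => e e' a; ring.
  move: E; move: (expR _) (partial (rshift n j) (partial (rshift n j) u) x)
    (partial (lshift n j) (partial (lshift n j) u) x) (partial (lshift n j) u x) => e b a c <-.
  by rewrite /=; field.
have [detp lndet] := usol x.
move: detp lndet; rewrite HM det_map_mx/= => detp lndet.
have {}detp : 0 < \det M by move: detp; rewrite -[0]/(real_complex R 0) ltcR.
have detM : \det M = expR (\sum_i euler i u x - u x).
  rewrite -[LHS]lnK ?posrE// lndet; congr expR; congr (_ - _).
  rewrite /dotprod big_split_ord/= [X in _ + X]big1 => [|i _]; last by rewrite slicer mul0r.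
  by rewrite addr0 mulr_sumr; apply: eq_bigr => i _; rewrite [gradient _ _ _ _]mxE.
rewrite HD !det_mulmx det_diag detM mulrAC -expr2.
have -> : \prod_i D 0 i = expR (\sum_i s 0 i / 2).
  by rewrite expR_sum; apply: eq_bigr => i _; rewrite mxE.
rewrite -expRM_natl -expRD; congr expR.
by rewrite -mulr_suml -addrA; congr (_ + _); field.
Qed.
End Toric.

(** * First and second order consequences of convexity *)

Section Convex.
Context {R : realType}.

Lemma convex_le_line d (u : 'rV[R]_d -> R) (x y : 'rV[R]_d) (t : R) :
  convex_function [set: 'rV[R]_d]%classic u -> 0 <= t <= 1 ->
  u (x + t *: (y - x)) <= u x + t * (u y - u x).
Proof.
move=> uc /andP[t0 t1]; have := uc (Itv01 t0 t1) y x; rewrite !in_setE => /(_ I I).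
rewrite /conv/= /unstable.onem.
have -> : t *: y + (1 - t) *: x = x + t *: (y - x).
  by rewrite scalerBl scale1r scalerBr addrCA addrA addrC addrA.
move=> /le_trans; apply; rewrite le_eqVlt; apply/orP; left; apply/eqP.
transitivity (t * u y + (1 - t) * u x) => //; ring.
Qed.

(** By [convex_le_line] the difference quotients from [x] towards [y] with steps in [(0, 1]] are at
    most [u y - u x], hence so is their limit. *)
Lemma convex_tangent d (u : 'rV[R]_d -> R) (x y : 'rV[R]_d) : smooth u ->
  convex_function [set: 'rV[R]_d]%classic u ->
  u x + \sum_k (y - x) 0 k * partial k u x <= u y.
Proof.
move=> us uc; rewrite -lerBrDl.
have ud : is_derive (0 : R) 1 (fun t => u (x + t *: (y - x))) (\sum_k (y - x) 0 k * partial k u x).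
  by apply: is_derive_line; rewrite scale0r addr0; exact: smooth_is_derive.
have [ud0 <-] := ud.
rewrite leNgt; apply/negP => H.
have : \forall h \near dnbhs (0 : R),
    u y - u x < h^-1 *: (u (x + (h *: 1 + 0) *: (y - x)) - u (x + 0 *: (y - x))).
  by apply: (cvgr_gt _ ud0).
move=> /nbhs_ballP[q /= q0 qP].
pose h := Num.min q 1 / 2.
have h0 : 0 < h by rewrite divr_gt0// lt_min q0 ltr01.
have hm : h < Num.min q 1 by have := h0; rewrite /h; lra.
move: hm; rewrite lt_min => /andP[hq h1].
have := qP h; rewrite /ball/= sub0r normrN gtr0_norm// => /(_ hq).
rewrite gt_eqF// => /(_ isT); rewrite addr0 scale0r addr0 [h *: 1]mulr1.
rewrite ltr_pdivlMl// ltNge; apply/negP; rewrite negbK lerBlDl.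
by apply: convex_le_line => //; rewrite (ltW h0) ltW.
Qed.

Lemma jet2_line d (u : 'rV[R]_d -> R) (x v : 'rV[R]_d) : smooth u ->
  jet2 (fun t => u (x + t *: v)) (u x) (\sum_k v 0 k * partial k u x)
    (\sum_k \sum_l v 0 k * v 0 l * partial l (partial k u) x).
Proof.
move=> us.
have line (F : 'rV[R]_d -> R) (t : R) : smooth F -> is_derive t 1 (fun t => F (x + t *: v))
    (\sum_k v 0 k * partial k F (x + t *: v)).
  by move=> Fs; apply: is_derive_line; exact: smooth_is_derive.
split; first by rewrite scale0r addr0.
exists (fun t => \sum_k v 0 k * partial k u (x + t *: v)) => [t|]; first exact: line.
split; first by rewrite scale0r addr0.
have D := is_derive_bigsum (index_enum 'I_d) (fun k =>
  is_deriveZ (v 0 k) (line _ 0 (smooth_partial k us))).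
apply: is_derive_eq D _; apply: eq_bigr => k _.
by rewrite scale0r addr0 /GRing.scale/= mulr_sumr; apply: eq_bigr => l _; rewrite mulrA.
Qed.

(** The tangent line minus [u] has a maximum at the point of contact, so [jet2_max] applies. *)
Lemma convex_hessian_ge0 d (u : 'rV[R]_d -> R) (x v : 'rV[R]_d) : smooth u ->
  convex_function [set: 'rV[R]_d]%classic u ->
  0 <= \sum_k \sum_l v 0 k * v 0 l * partial l (partial k u) x.
Proof.
move=> us uc; have gj := jet2_line x v us; set g1 := \sum_k v 0 k * _ in gj.
have := jet2D (jet2Z (-1) gj) (jet2_affine (u x) g1).
move=> /jet2_max[|_]; last by rewrite addr0 mulN1r oppr_le0.
apply/nbhs_ballP; exists 1 => //= t _.
rewrite mul0r addr0 scale0r addr0 !mulN1r addNr addrC subr_le0.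
have := convex_tangent x (x + t *: v) us uc; apply: le_trans; rewrite lerD2l.
rewrite addrC addKr /g1 mulr_sumr le_eqVlt; apply/orP; left; apply/eqP/eq_bigr => k _.
by rewrite mxE mulrCA mulrA [v 0 k * t]mulrC.
Qed.
End Convex.

(** * Estimates for the potential and its derivatives on the slice *)

Lemma continuous_rV (R : realType) (T : topologicalType) m (g : T -> 'rV[R]_m) :
  (forall k, continuous (fun t => g t 0 k)) -> continuous g.
Proof.
move=> gc t; apply/cvgrPdist_le => e e0.
have : \forall y \near t, forall k, `|g t 0 k - g y 0 k| <= e.
  have := @filter_forall _ _ (fun k y => `|g t 0 k - g y 0 k| <= e) _ (nbhs_filter t).
  by apply => k; have /cvgrPdist_le := gc k t; apply.
apply: filterS => y H; apply: ler_norm_coord; first exact: ltW.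
by move=> k; rewrite !mxE.
Qed.

(** For [t >= 0], [e^(t/2) >= (t/4)^2], and [a (t/4)^2 + 16 / a - 2 t] is a square divided by [a].
    For [t < 0] the left side is 0. *)
Lemma abs_le_expR (R : realType) (a t : R) : 0 < a ->
  `|t| + t <= a * expR (t / 2) + 16 / a.
Proof.
move=> a0; have [t0|t0] := leP 0 t; last first.
  by rewrite ltr0_norm// addNr addr_ge0 ?mulr_ge0 ?expR_ge0 ?invr_ge0 ?ltW.
rewrite ger0_norm//.
have H1 : (t / 4) ^+ 2 <= expR (t / 2).
  have -> : t / 2 = t / 4 + t / 4 by field.
  rewrite expRD -expr2 ler_pXn2r ?nnegrE ?expR_ge0//; last by rewrite divr_ge0.
  by apply: le_trans (expR_ge1Dx _); rewrite lerDr.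
have H2 : a * (t / 4) ^+ 2 <= a * expR (t / 2) by rewrite ler_pM2l.
apply: le_trans (lerD H2 (lexx _)).
have -> : a * (t / 4) ^+ 2 + 16 / a = (a * t / 4 - 4) ^+ 2 / a + (t + t).
  by field; rewrite gt_eqF.
by rewrite lerDr divr_ge0 ?sqr_ge0// ltW.
Qed.

Section ConvexToric.
Context {R : realType} {n : nat}.
Context (u : 'rV[R]_(n + n) -> R)
  (us : smooth u) (uc : convex_function [set: 'rV[R]_(n + n)]%classic u)
  (usol : is_solution u) (ut : toric u).
Implicit Types (s v : 'rV[R]_n) (i j : 'I_n).

(** This and the next two functions are [phi], [psi] and [S] of the header. *)
Definition potential s := u (slice s) - u 0.
Definition moment s := \sum_i euler i u (slice s).
Definition radial_hessian s := \sum_i \sum_j euler j (euler i u) (slice s).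

Lemma continuous_slice : continuous (@slice R n).
Proof.
apply: continuous_rV => k; case: (split_ordP k) => i ->.
  under eq_fun do rewrite slicel.
  move=> s; apply: (@continuous_comp _ _ _ (fun s : 'rV[R]_n => s 0 i / 2) (@expR R)).
    apply: (@continuousM _ _ (fun s : 'rV[R]_n => s 0 i) (cst _)).
      exact: coord_continuous.
    exact: cst_continuous.
  exact: continuous_expR.
by under eq_fun do rewrite slicer; exact: cst_continuous.
Qed.

Lemma continuous_smooth_slice F : smooth F -> continuous (F \o @slice R n).
Proof.
move=> /smooth_continuous Fc s; apply: continuous_comp; first exact: continuous_slice.
exact: Fc.
Qed.

Lemma tangent_slice s (w : 'rV[R]_n) :
  u (slice s) + \sum_i (w 0 i - expR (s 0 i / 2)) * partial (lshift n i) u (slice s)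
    <= u (row_mx w 0).
Proof.
have := convex_tangent (slice s) (row_mx w 0) us uc; apply: le_trans; rewrite lerD2l.
rewrite big_split_ord/= [X in _ <= _ + X]big1 ?addr0 => [|i _]; last first.
  by rewrite partial_slice_r// mulr0.
rewrite le_eqVlt; apply/orP; left; apply/eqP/eq_bigr => i _.
by rewrite mxE [X in _ = (_ + X) * _]mxE slicel row_mxEl.
Qed.

(** Rotating [z_i] by [pi] preserves [u]; the tangent inequality at [slice s], evaluated at the
    rotated point, gives [- 2 x_i d_i u <= 0]. *)
Lemma euler_ge0 i s : 0 <= euler i u (slice s).
Proof.
pose w : 'rV[R]_n := \row_j (cos (pi * (j == i)%:R) * expR (s 0 j / 2)).
have := tangent_slice s w.
have -> : u (row_mx w 0) = u (slice s).
  rewrite -(toric_rot (pi *: delta_mx 0 i) (slice s) ut); congr u.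
  apply/rowP => k; case: (split_ordP k) => j ->; rewrite ?rotl ?rotr slicel slicer.
    by rewrite row_mxEl !mxE eqxx/= mulr0 subr0.
  rewrite row_mxEr !mxE eqxx/=.
  by case: (j == i); rewrite ?mulr1 ?mulr0 ?sinpi ?sin0 !mul0r addr0.
rewrite gerDl (bigD1 i)//= big1 ?addr0 => [|j ji]; last first.
  by rewrite mxE (negPf ji) mulr0 cos0 mul1r subrr mul0r.
rewrite mxE eqxx mulr1 cospi /euler slicel mulN1r => H.
by rewrite mulr_ge0// -oppr_le0; move: H; rewrite -opprD mulNr mulrDl; lra.
Qed.

(** Convexity of [u] in the direction [v_i e^(s_i / 2)]: the left side is the diagonal term of
    [eulerE], and the rest is a nonnegative second derivative of [u]. *)
Lemma hessian_slice_ge s v :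
  2^-1 * \sum_i v 0 i ^+ 2 * euler i u (slice s) <=
  \sum_i \sum_j v 0 i * v 0 j * euler j (euler i u) (slice s).
Proof.
have := convex_hessian_ge0 (slice s) (row_mx (\row_i (v 0 i * expR (s 0 i / 2))) 0) us uc.
set H := \sum_k _.
have -> : H = \sum_i \sum_j v 0 i * expR (s 0 i / 2) * (v 0 j * expR (s 0 j / 2))
    * partial (lshift n j) (partial (lshift n i) u) (slice s).
  rewrite /H big_split_ord/= [X in _ + X]big1 ?addr0 => [|i _]; last first.
    by apply: big1 => j _; rewrite row_mxEr mxE !mul0r.
  apply: eq_bigr => i _; rewrite big_split_ord/= [X in _ + X]big1 ?addr0 => [|j _]; last first.
    by rewrite row_mxEr [X in _ * X * _]mxE mulr0 mul0r.
  by apply: eq_bigr => j _; rewrite !row_mxEl !mxE.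
move=> H0; rewrite -subr_ge0.
have -> : \sum_i \sum_j v 0 i * v 0 j * euler j (euler i u) (slice s) -
   2^-1 * \sum_i v 0 i ^+ 2 * euler i u (slice s) =
   4^-1 * \sum_i \sum_j v 0 i * expR (s 0 i / 2) * (v 0 j * expR (s 0 j / 2))
    * partial (lshift n j) (partial (lshift n i) u) (slice s).
  rewrite !mulr_sumr -sumrB; apply: eq_bigr => i _.
  rewrite mulr_sumr (eq_bigr (fun j => 4^-1 * (v 0 i * expR (s 0 i / 2) *
     (v 0 j * expR (s 0 j / 2)) * partial (lshift n j) (partial (lshift n i) u) (slice s))
     + (j == i)%:R * (v 0 i * v 0 j * (2^-1 * euler i u (slice s))))); last first.
    by move=> j _; rewrite (eulerE j i _ us) !slicel; ring.
  rewrite big_split/= sum_delta -addrA; rewrite [X in _ + X](_ : _ = 0) ?addr0//; ring.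
by rewrite mulr_ge0.
Qed.

Lemma quadformE (A : 'M[R]_n) v : quadform A v = \sum_i \sum_j v 0 i * v 0 j * A i j.
Proof.
rewrite /quadform mxE exchange_big/=; apply: eq_bigr => j _.
rewrite [v^T _ _]mxE mxE mulr_suml; apply: eq_bigr => i _; ring.
Qed.

Lemma hessian_slice_sym s : (hessian_slice u s)^T = hessian_slice u s.
Proof. by apply/matrixP => i j; rewrite !mxE eulerC. Qed.

Lemma quadform_hessian s v : quadform (hessian_slice u s) v =
  \sum_i \sum_j v 0 i * v 0 j * euler j (euler i u) (slice s).
Proof.
rewrite quadformE; apply: eq_bigr => i _; apply: eq_bigr => j _.
by rewrite mxE (eulerC i j us).
Qed.

(** Convexity gives semidefiniteness, and the equation gives a nonzero determinant. *)
Lemma hessian_slice_gt0 s v : v != 0 -> 0 < quadform (hessian_slice u s) v.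
Proof.
apply: psd_unit_pd; first exact: hessian_slice_sym.
  by rewrite unitmxE unitfE det_hessian_slice// gt_eqF// expR_gt0.
move=> {}v; rewrite quadform_hessian; apply: le_trans (hessian_slice_ge s v).
rewrite mulr_ge0// sumr_ge0// => i _; rewrite mulr_ge0 ?sqr_ge0//; exact: euler_ge0.
Qed.

(** The value one unit back along [s_i] is nonnegative, and the derivative along [s_i] is a diagonal
    entry of a positive definite matrix. *)
Lemma euler_gt0 i s : 0 < euler i u (slice s).
Proof.
pose g t := euler i u (slice (s + t *: delta_mx 0 i)).
pose dg t := euler i (euler i u) (slice (s + t *: delta_mx 0 i)).
have gd (t : R) : is_derive t 1 g (dg t).
  apply: is_derive_eq (is_derive_slice s (delta_mx 0 i) t (smooth_euler i us)) _.
  by under eq_bigr do rewrite mxE eqxx/=; rewrite sum_delta.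
have [|c _] := @MVT R g dg (-1) 0 (ltrN10 R) (fun t _ => gd t).
  apply: derivable_within_continuous => t _; by case: (gd t).
rewrite {1}/g scale0r addr0 sub0r opprK mulr1 => /eqP; rewrite subr_eq => /eqP ->.
apply: ltr_wpDr; first exact: euler_ge0.
have : (delta_mx 0 i : 'rV[R]_n) != 0.
  by apply/eqP => /matrixP/(_ 0 i); rewrite !mxE !eqxx => /eqP; rewrite oner_eq0.
move=> /(hessian_slice_gt0 (s + c *: delta_mx 0 i)); rewrite quadform_hessian.
under eq_bigr do under eq_bigr do rewrite !mxE !eqxx/= -mulrA.
by under eq_bigr do rewrite -mulr_sumr sum_delta; rewrite sum_delta.
Qed.

Lemma moment_gt0 s : (0 < n)%N -> 0 < moment s.
Proof.
move=> n0; rewrite /moment (bigD1 (Ordinal n0))//=.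
rewrite ltr_pwDl ?euler_gt0// sumr_ge0// => i _; exact: euler_ge0.
Qed.

Lemma moment_radial s : moment s / 2 <= radial_hessian s.
Proof.
have := hessian_slice_ge s (const_mx 1).
rewrite /moment /radial_hessian mulrC.
have -> : \sum_i (const_mx 1 : 'rV[R]_n) 0 i ^+ 2 * euler i u (slice s)
   = \sum_i euler i u (slice s).
  by apply: eq_bigr => i _; rewrite mxE expr1n mul1r.
congr (_ <= _); apply: eq_bigr => i _; apply: eq_bigr => j _.
by rewrite !mxE !mul1r.
Qed.

Lemma dotprod_slice s : \sum_i expR (s 0 i / 2) * partial (lshift n i) u (slice s) = 2 * moment s.
Proof.
rewrite /moment mulr_sumr; apply: eq_bigr => i _; rewrite /euler slicel.
by rewrite mulrA mulfV// mul1r.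
Qed.

(** The tangent inequalities at the origin towards [slice s] and its opposite have opposite linear
    terms, while [u] is even. *)
Lemma potential_ge0 s : 0 <= potential s.
Proof.
have H1 := convex_tangent 0 (slice s) us uc; have := convex_tangent 0 (- slice s) us uc.
rewrite toric_opp// => H2; rewrite /potential.
have : \sum_k (slice s - 0) 0 k * partial k u 0 = - \sum_k (- slice s - 0) 0 k * partial k u 0.
  by rewrite -sumrN; apply: eq_bigr => k _; rewrite !subr0 [(- _ : 'rV__) _ _]mxE mulNr opprK.
by move: H1 H2; lra.
Qed.

(** Tangent inequality at [slice s], evaluated at the origin. *)
Lemma potential_le s : potential s <= 2 * moment s.
Proof.
have := tangent_slice s 0; rewrite row_mx0 /potential -dotprod_slice.
under eq_bigr do rewrite mxE sub0r mulNr.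
by rewrite sumrN; lra.
Qed.

(** The tangent plane at [slice 0] has positive slopes [a i], so [u] dominates
    [sum_i a_i e^(s_i / 2)] up to a constant, and [abs_le_expR] applies. *)
Lemma potential_coercive : exists C, forall s,
  \sum_i `|s 0 i| <= potential s - \sum_i s 0 i + C.
Proof.
pose a i := partial (lshift n i) u (slice 0).
have a0 i : 0 < a i.
  have := euler_gt0 i 0; rewrite /euler slicel mxE mul0r expR0 mul1r -/(a i).
  by rewrite pmulr_rgt0// invr_gt0.
exists (\sum_i (16 / a i + a i) + u 0 - u (slice 0)) => s.
have := tangent_slice 0 (\row_i expR (s 0 i / 2)).
rewrite -[row_mx _ _]/(slice s) /potential.
have -> : \sum_i ((\row_i0 expR (s 0 i0 / 2)) 0 i - expR ((0 : 'rV[R]_n) 0 i / 2)) *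
   partial (lshift n i) u (slice 0) = \sum_i a i * expR (s 0 i / 2) - \sum_i a i.
  by rewrite -sumrB; apply: eq_bigr => i _; rewrite !mxE mul0r expR0 -/(a i); ring.
have : \sum_i `|s 0 i| + \sum_i s 0 i <= \sum_i a i * expR (s 0 i / 2) + \sum_i (16 / a i).
  rewrite -!big_split/=; apply: ler_sum => i _; exact: abs_le_expR.
rewrite big_split/=; lra.
Qed.

(** A bound on the potential bounds all coordinates of [slice s] by [rho]. In the tangent inequality
    towards the point with all real coordinates [2 rho], the increments [2 rho - x_i] are at least
    [x_i], so the linear term is at least [2 psi]. *)
Lemma moment_bounded C : exists K, forall s, potential s <= C -> moment s <= K.
Proof.
have [C' HC'] := potential_coercive.
pose rho := expR ((C + C') / 2).
exists ((u (row_mx (const_mx (2 * rho)) 0) - u 0) / 2) => s sC.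
have srho i : expR (s 0 i / 2) <= rho.
  rewrite ler_expR ler_pM2r//.
  have H1 : 0 <= \sum_(j | j != i) (`|s 0 j| + s 0 j).
    by apply: sumr_ge0 => j _; rewrite -lerBlDr sub0r -normrN ler_norm.
  have : `|s 0 i| + s 0 i + \sum_(j | j != i) (`|s 0 j| + s 0 j) <= C + C'.
    rewrite -(bigD1 i (P := predT) (F := fun j => `|s 0 j| + s 0 j))//= big_split/=.
    by have := HC' s; lra.
  have := ler_norm (s 0 i); have := normr_ge0 (s 0 i); lra.
have := tangent_slice s (const_mx (2 * rho)).
have : \sum_i expR (s 0 i / 2) * partial (lshift n i) u (slice s) <=
  \sum_i ((const_mx (2 * rho) : 'rV[R]_n) 0 i - expR (s 0 i / 2))
    * partial (lshift n i) u (slice s).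
  apply: ler_sum => i _; rewrite mxE ler_wpM2r//; last by have := srho i; lra.
  have := euler_ge0 i s; rewrite /euler slicel pmulr_rge0 ?invr_gt0//.
  by rewrite pmulr_rge0// expR_gt0.
have := potential_ge0 s.
rewrite dotprod_slice /potential; lra.
Qed.
End ConvexToric.

(** * The soliton equation in an orthonormal frame *)

Lemma frame_dual (R : realType) n (A P : 'M[R]_n) (a b : 'rV[R]_n) : A^T = A ->
  P *m A *m P^T = 1%:M ->
  \sum_k (a *m P^T) 0 k * (b *m A *m P^T) 0 k = (a *m b^T) 0 0.
Proof.
(* [P^T P] is the inverse of [A], so the sum is the product of the covectors [a] and [b A] for the
   metric [A]. *)
move=> As PA; have PPA : P^T *m (P *m A) = 1%:M by apply: mulmx1C.
transitivity ((a *m P^T *m (b *m A *m P^T)^T) 0 0).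
  by rewrite [RHS]mxE; apply: eq_bigr => k _; congr (_ * _); rewrite [RHS]mxE.
by rewrite !trmx_mul trmxK As !mulmxA -(mulmxA a) -(mulmxA a) -(mulmxA P^T) PPA mulmx1.
Qed.

Lemma quadform_row (R : realType) n (A P : 'M[R]_n) k :
  quadform A (row k P) = (P *m A *m P^T) k k.
Proof.
rewrite /quadform -row_mul mxE [RHS]mxE; apply: eq_bigr => j _.
by rewrite !mxE.
Qed.

Section SolitonEquation.
Context {R : realType} {n : nat} (u : 'rV[R]_(n + n) -> R)
  (us : smooth u) (uc : convex_function [set: 'rV[R]_(n + n)]%classic u)
  (usol : is_solution u) (ut : toric u).
Implicit Types (s v : 'rV[R]_n) (i j : 'I_n).

Let radial x := \sum_i euler i u x.

Let radial_smooth : smooth radial.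
Proof.
rewrite (_ : radial = fun x => \sum_i 1 * euler i u x); last first.
  by apply/funext => x; apply: eq_bigr => i _; rewrite mul1r.
by apply: smooth_sum => i; exact: smooth_euler.
Qed.

Let euler_radial i : euler i radial = fun x => \sum_k euler i (euler k u) x.
Proof. by apply/funext => x; apply: euler_sum => k; exact: smooth_euler. Qed.

Let euler2_radial i j x :
  euler j (euler i radial) x = \sum_k euler k (euler i (euler j u)) x.
Proof.
rewrite euler_radial euler_sum => [|k]; last exact/smooth_euler/smooth_euler.
apply: eq_bigr => k _.
rewrite (eulerC i k us) (eulerC j k (smooth_euler i us)) (eulerC j i us) //.
Qed.

Let jet2_potential s v : jet2 (fun t => potential u (s + t *: v)) (potential u s)
  (\sum_i v 0 i * euler i u (slice s))
  (quadform (hessian_slice u s) v).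
Proof.
have := jet2D (jet2_slice s v us) (jet2_cst (- u 0)).
by rewrite !addr0 quadform_hessian.
Qed.

(** The derivative of [D^2 phi] along [(1, ..., 1)], which is also the Hessian of [psi]. *)
Let dhessian s : 'M[R]_n := \matrix_(i, j) \sum_k euler k (euler i (euler j u)) (slice s).

Let jet2_moment s v : jet2 (fun t => moment u (s + t *: v)) (moment u s)
  (\sum_i v 0 i * \sum_k hessian_slice u s i k)
  (quadform (dhessian s) v).
Proof.
apply: jet2_eq (jet2_slice s v radial_smooth) _ _ _ => //.
  apply: eq_bigr => i _; rewrite euler_radial; congr (_ * _).
  by apply: eq_bigr => k _; rewrite mxE.
rewrite quadformE; apply: eq_bigr => i _; apply: eq_bigr => j _.
by rewrite euler2_radial mxE.
Qed.

(** Along [(1, ..., 1)] the exponent [sum_i s_i + psi - phi] has derivative [n + S - psi]. *)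
Let is_derive_det s : is_derive (0 : R) 1
  (fun t => \det (hessian_slice u (s + t *: const_mx 1)))
  (\det (hessian_slice u (s + 0 *: const_mx 1)) * (n%:R + radial_hessian u s - moment u s)).
Proof.
under eq_fun do rewrite det_hessian_slice//.
rewrite det_hessian_slice//.
have d1 : is_derive (0 : R) 1 (fun t => \sum_i (s + t *: const_mx 1 : 'rV[R]_n) 0 i) n%:R.
  under eq_fun do under eq_bigr do rewrite !mxE mulr1.
  under eq_fun do rewrite big_split/= sumr_const card_ord -mulr_natr.
  by apply: is_derive_eq; rewrite /GRing.scale/=; ring.
have sum1 (F : 'I_n -> R) : \sum_i (const_mx 1 : 'rV[R]_n) 0 i * F i = \sum_i F i.
  by apply: eq_bigr => i _; rewrite mxE mul1r.
have := is_derive_slice s (const_mx 1) 0 radial_smooth.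
have := is_derive_slice s (const_mx 1) 0 us.
rewrite !sum1 scale0r addr0 => d2 d3.
have D := is_derive1_comp (is_derive_expR _) (is_deriveB (is_deriveD d1 d3) d2).
apply: is_derive_eq D _; rewrite !fctE scale0r addr0; congr (_ * (_ + _ - _)).
rewrite /radial_hessian exchange_big/=; apply: eq_bigr => i _.
by rewrite euler_radial; apply: eq_bigr => j _.
Qed.

(** Since [d psi] is [D^2 phi] applied to [(1, ..., 1)], [frame_dual] evaluates both products. The
    trace of [D^2 phi] is that of the identity, and the trace of [D^2 psi] comes from [trace_frame]
    and the differentiated equation. *)
Let frame s : soliton_frame (potential u) (moment u) (radial_hessian u) s.
Proof.
have As := hessian_slice_sym us s.
have [P PA] := pd_frame As (@hessian_slice_gt0 _ _ _ us uc usol ut s).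
exists P, (fun k => \sum_i row k P 0 i * euler i u (slice s)),
  (fun k => quadform (hessian_slice u s) (row k P)),
  (fun k => \sum_i row k P 0 i * \sum_l hessian_slice u s i l),
  (fun k => quadform (dhessian s) (row k P)).
pose g : 'rV[R]_n := \row_i euler i u (slice s).
have f1E k : \sum_i row k P 0 i * euler i u (slice s) = (g *m P^T) 0 k.
  by rewrite [RHS]mxE; apply: eq_bigr => i _; rewrite !mxE mulrC.
have p1E k : \sum_i row k P 0 i * \sum_l hessian_slice u s i l =
    ((const_mx 1 : 'rV[R]_n) *m hessian_slice u s *m P^T) 0 k.
  rewrite [RHS]mxE; apply: eq_bigr => i _; rewrite [row k P 0 i]mxE [P^T i k]mxE mulrC.
  congr (_ * _); rewrite mxE; apply: eq_bigr => l _.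
  by rewrite [const_mx _ _ _]mxE mul1r -[in LHS]As mxE.
split.
- by move=> k; exact: jet2_potential.
- by move=> k; exact: jet2_moment.
- under eq_bigr do rewrite quadform_row.
  by rewrite -/(\tr _) PA mxtrace1.
- under eq_bigr do rewrite quadform_row.
  rewrite -/(\tr _).
  apply: (@trace_frame R n (fun t => hessian_slice u (s + t *: const_mx 1)) (dhessian s) P 0).
  + move=> i j; under eq_fun do rewrite mxE.
    apply: is_derive_eq (is_derive_slice s (const_mx 1) 0 _) _.
      exact/smooth_euler/smooth_euler.
    by rewrite scale0r addr0 mxE; apply: eq_bigr => k _; rewrite mxE mul1r.
  + by rewrite scale0r addr0.
  + exact: is_derive_det.
- split.
    under eq_bigr do rewrite f1E p1E.
    rewrite frame_dual// mxE; apply: eq_bigr => i _.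
    by rewrite !mxE mulr1.
  under eq_bigr do rewrite p1E expr2.
  rewrite frame_dual// mxE /radial_hessian exchange_big/=; apply: eq_bigr => i _.
  rewrite [_^T _ _]mxE [const_mx _ _ _]mxE mulr1 mxE; apply: eq_bigr => j _.
  by rewrite !mxE mul1r (eulerC i j us).
Qed.

Lemma moment_potential s : (0 < n)%N -> moment u s = potential u s.
Proof.
move=> n0; move: s.
apply: (@soliton_liouville R n (potential u) (moment u) (radial_hessian u)).
- move=> s; apply: continuousB; last exact: cst_continuous.
  exact: continuous_smooth_slice.
- exact: (continuous_smooth_slice radial_smooth).
- by move=> s; exact: moment_gt0.
- by move=> s; exact: potential_ge0.
- by move=> s; exact: potential_le.
- by move=> s; exact: moment_radial.
- exact: frame.
- move=> s; exists (quadform (hessian_slice u s) (const_mx 1)).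
  apply: jet2_eq (jet2_potential s (const_mx 1)) _ _ _ => //.
  by apply: eq_bigr => i _; rewrite mxE mul1r.
- move=> s; exists (quadform (dhessian s) (const_mx 1)).
  apply: jet2_eq (jet2_moment s (const_mx 1)) _ _ _ => //.
  rewrite /radial_hessian exchange_big/=; apply: eq_bigr => i _.
  by rewrite mxE mul1r; apply: eq_bigr => j _; rewrite mxE.
- exact: potential_coercive.
- exact: moment_bounded.
Qed.
End SolitonEquation.

(** * From homogeneity to a quadratic polynomial *)

Lemma jet2_unique (R : realType) (g : R -> R) (a b c a' b' c' : R) :
  jet2 g a b c -> jet2 g a' b' c' -> c = c'.
Proof.
move=> [_ [dg gd [_ dgd]]] [_ [dg' gd' [_ dgd']]].
have E : dg = dg' by apply/funext => t; have [_ <-] := gd t; have [_ <-] := gd' t.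
by rewrite E in dgd; have [_ <-] := dgd; have [_ <-] := dgd'.
Qed.

Lemma exp_growth (R : realType) (g : R -> R) : (forall t : R, is_derive t 1 g (g t)) ->
  forall t, g t = expR t * g 0.
Proof.
move=> gd t.
have D (x : R) : is_derive x 1 (fun x => expR (- x) * g x) 0.
  have Ne : is_derive x 1 (fun x => expR (- x)) (expR (- x) * -1).
    by apply: is_derive1_comp.
  by apply: is_derive_eq (is_deriveM Ne (gd x)) _; rewrite /GRing.scale/=; ring.
have := is_derive_0_is_cst t 0 D; rewrite oppr0 expR0 mul1r => <-.
by rewrite mulrA -expRD subrr expR0 mul1r.
Qed.

Lemma polar (R : realType) (a b : R) : a ^+ 2 + b ^+ 2 = 1 ->
  exists t, a = cos t /\ b = sin t.
Proof.
move=> ab; have a1 : -1 <= a <= 1.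
  by rewrite -ler_norml -(ler_pXn2r (_ : 0 < 2)%N) ?nnegrE// expr1n real_normK ?num_real//
     -ab lerDl sqr_ge0.
have sb : Num.sqrt (1 - a ^+ 2) = `|b| by rewrite -ab addrAC subrr add0r sqrtr_sqr.
have [b0|b0] := leP 0 b.
  exists (acos a); rewrite acosK ?in_itv//= sin_acos// sb ger0_norm//.
exists (- acos a); rewrite cosN sinN acosK ?in_itv//= sin_acos// sb ltr0_norm// opprK//.
Qed.

Section Homogeneity.
Context {R : realType} {n : nat} (u : 'rV[R]_(n + n) -> R)
  (us : smooth u) (uc : convex_function [set: 'rV[R]_(n + n)]%classic u)
  (usol : is_solution u) (ut : toric u) (n0 : (0 < n)%N).
Implicit Types (x : 'rV[R]_(n + n)) (s : 'rV[R]_n).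

(** The derivative of the potential along [(1, ..., 1)] is the moment, hence the potential
    itself. *)
Lemma potential_scale s (t : R) : potential u (s + t *: const_mx 1) = expR t * potential u s.
Proof.
suff gd (x : R) : is_derive x 1 (fun t => potential u (s + t *: const_mx 1))
    (potential u (s + x *: const_mx 1)).
  by have := exp_growth gd t; rewrite scale0r addr0.
apply: is_derive_eq (is_deriveB (is_derive_slice s (const_mx 1) x us)
  (is_derive_cst (u 0) x 1)) _.
rewrite subr0 -(moment_potential us uc usol ut _ n0) /moment.
by apply: eq_bigr => i _; rewrite mxE mul1r.
Qed.

Lemma slice_shift s (r : R) : 0 < r ->
  slice (s + (2 * ln r) *: const_mx 1) = r *: slice s.
Proof.
move=> r0; apply/rowP => k; rewrite [RHS]mxE; case: (split_ordP k) => i ->.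
  rewrite !slicel !mxE mulr1 mulrDl expRD mulrC; congr (_ * _).
  by rewrite mulrAC divff// mul1r lnK.
by rewrite !slicer mulr0.
Qed.

(** Polar coordinates in each factor; the hypothesis makes every modulus positive. *)
Lemma rot_polar x : (forall j, x 0 (lshift n j) != 0) -> exists t s, x = rot t (slice s).
Proof.
move=> x0.
pose r2 j := x 0 (lshift n j) ^+ 2 + x 0 (rshift n j) ^+ 2.
have r20 j : 0 < r2 j by rewrite ltr_pwDl ?sqr_ge0// lt_neqAle eq_sym sqrf_eq0 x0 sqr_ge0.
pose r j := Num.sqrt (r2 j).
have r0 j : 0 < r j by rewrite sqrtr_gt0.
have rr j : r j ^+ 2 = r2 j by rewrite sqr_sqrtr// ltW.
have H j : exists t, x 0 (lshift n j) / r j = cos t /\ x 0 (rshift n j) / r j = sin t.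
  by apply: polar; rewrite !expr_div_n !rr -mulrDl -/(r2 j) divff// gt_eqF.
have [t tE] := choice H.
exists (\row_j t j), (\row_j (2 * ln (r j))).
have sl j : expR ((2 * ln (r j)) / 2) = r j by rewrite mulrAC divff// mul1r lnK ?posrE ?r0.
apply/rowP => k; case: (split_ordP k) => j ->; have [tc ts] := tE j.
  by rewrite rotl slicel slicer !mxE sl mulr0 subr0 -tc divfK// gt_eqF.
by rewrite rotr slicel slicer !mxE sl mulr0 add0r -ts divfK// gt_eqF.
Qed.

Lemma rotZ t (c : R) x : rot t (c *: x) = c *: rot t x.
Proof.
apply/rowP => k; rewrite [RHS]mxE; case: (split_ordP k) => j ->.
  by rewrite !rotl !mxE; ring.
by rewrite !rotr !mxE; ring.
Qed.

(** For [c > 0], rotate [x] onto the slice, where scaling by [c] is the shift by [2 ln c] along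
    [(1, ..., 1)]; for [c < 0] use evenness. *)
Lemma homogeneous2 x (c : R) : (forall j, x 0 (lshift n j) != 0) ->
  u (c *: x) = u 0 + c ^+ 2 * (u x - u 0).
Proof.
move=> x0.
have pos (r : R) : 0 < r -> u (r *: x) = u 0 + r ^+ 2 * (u x - u 0).
  move=> r0; have [t [s ->]] := rot_polar x0.
  rewrite -rotZ !toric_rot// -slice_shift//.
  have := potential_scale s (2 * ln r); rewrite /potential expRM_natl lnK// => <-.
  by rewrite [RHS]addrC subrK.
have [c0|c0|->] := ltgtP c 0; last by rewrite scale0r expr0n mul0r addr0.
  by rewrite -(toric_opp _ ut) -scaleNr pos ?oppr_gt0// sqrrN.
exact: pos.
Qed.

Let quad x := 2^-1 * \sum_k \sum_l x 0 k * x 0 l * partial l (partial k u) 0.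

(** By homogeneity [t -> u (t x)] is exactly [u 0 + t^2 (u x - u 0)]; comparing second derivatives
    at 0 identifies the coefficient. *)
Lemma quadratic_generic x : (forall j, x 0 (lshift n j) != 0) -> u x = u 0 + quad x.
Proof.
move=> x0.
have lj := jet2_affine 0 (1 : R).
have := jet2D (jet2_cst (u 0)) (jet2Z (u x - u 0) (jet2M lj lj)).
have <- : (fun t => u (0 + t *: x)) =
    (fun t => cst (u 0) t + (u x - u 0) * ((0 + t * 1) * (0 + t * 1))).
  by apply/funext => t; rewrite !add0r mulr1 homogeneous2// -expr2 mulrC.
move/(jet2_unique (jet2_line 0 x us)); rewrite /quad => ->.
by rewrite !mul0r !add0r !mulr1; field.
Qed.

(** Extension by continuity: [x + h (1, ..., 1)] satisfies the condition of [quadratic_generic] for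
    all small [h != 0]. *)
Lemma quadratic_formula x : u x = u 0 + quad x.
Proof.
pose D (h : R) := u (x + h *: const_mx 1) - (u 0 + quad (x + h *: const_mx 1)).
have linec k : continuous (fun h : R => (x + h *: const_mx 1) 0 k).
  move=> h; under eq_fun do rewrite !mxE mulr1.
  by apply: continuousD; [exact: cst_continuous|exact: cvg_id].
have Dc : {for 0, continuous D}.
  apply: continuousB.
    apply: (@continuous_comp _ _ _ (fun h : R => x + h *: const_mx 1) u).
      by apply: continuous_rV => k; exact: linec.
    exact: smooth_continuous.
  apply: continuousD; first exact: cst_continuous.
  apply: (@continuousM _ _ (cst 2^-1)); first exact: cst_continuous.
  apply: continuous_sum => k; apply: continuous_sum => l h.
  have cc : {for h, continuous (fun _ : R => partial l (partial k u) 0)}.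
    exact: cst_continuous.
  exact: (continuousM (continuousM (linec k h) (linec l h)) cc).
have D0 : \forall h \near dnbhs (0 : R), D h = 0.
  have : \forall h \near dnbhs (0 : R), forall j : 'I_n, (x + h *: const_mx 1) 0 (lshift n j) != 0.
    have := @filter_forall _ _ (fun (j : 'I_n) (h : R) => (x + h *: const_mx 1) 0 (lshift n j) != 0)
      _ (dnbhs_filter (0 : R)).
    apply => j; have [xj|xj] := eqVneq (x 0 (lshift n j)) 0.
      apply: filterS (nbhs_dnbhs_neq (0 : R)) => h h0.
      by rewrite !mxE xj add0r mulr1.
    apply: nbhs_dnbhs; have := linec (lshift n j) 0.
    by move/(cvgr_neq0 _); apply; rewrite scale0r addr0.
  by apply: filterS => h hx; rewrite /D quadratic_generic// subrr.
have : D 0 = 0.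
  apply: (@cvg_unique _ _ (D @ dnbhs (0 : R))%classic).
  - exact: norm_hausdorff.
  - by apply: cvg_trans Dc; apply: cvg_app; exact: cvg_within.
  - by apply: cvg_near_cst.
by rewrite /D scale0r addr0 => /eqP; rewrite subr_eq0 => /eqP.
Qed.
End Homogeneity.

Theorem theorem1p4 (R : realType) (n : nat) (hn : (1 <= n)%N)
    (u : 'rV[R]_(n + n) -> R)
    (u_smooth : smooth u)
    (u_convex : convex_function [set: 'rV[R]_(n + n)]%classic u)
    (u_solution : is_solution u)
    (u_toric : toric u) :
  quadratic u.
Proof.
exists (\matrix_(k, l) (2^-1 * partial l (partial k u) 0)), 0, (u 0) => x.
rewrite (quadratic_formula u_smooth u_convex u_solution u_toric hn) addrC; congr (_ + _).
rewrite [X in _ + X]big1 ?addr0 => [|k _]; last by rewrite mxE mul0r.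
rewrite mulr_sumr; apply: eq_bigr => k _; rewrite mulr_sumr; apply: eq_bigr => l _.
by rewrite mxE; ring.
Qed.
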